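(* For every $n\ge 1$ there is a bijection $\Psi_n$ from the set of PDSAWs in the asymmetric wedge (that is, staying below the $x$-axis) with $n$ east steps to the set of permutations of $[n]=\{1,\dots,n\}$ such that, for every such PDSAW $P$ and all integers $N$, $M$, the path $P$ has - exactly $N$ north steps and - last descent of length $M$ if and only if the permutation $\sigma=\Psi_n(P)$ has - exactly $N$ nestings and - $\sigma(1)=M$. Moreover, the bijections $\Psi_n$ ($n\ge 1$) can be chosen so that factors are preserved with their order reversed (in particular the last factor of the PDSAW is mapped to the first factor of the permutation): if $P_1,P_2,\dots,P_r$ are the consecutive prime factors of $P$, with $P_i$ having $n_i$ east steps, then the consecutive prime factors of the permutation $\Psi_n(P)$, from left to right, are $\Psi_{n_r}(P_r),\Psi_{n_{r-1}}(P_{r-1}),\dots,\Psi_{n_1}(P_1)$ (where each $P_i$ is translated so as to start at the origin, and each factor of the permutation is relabelled order-preservingly to a permutation of an initial interval $[n_i]$).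
   Context: A partially directed self avoiding walk (PDSAW) is a walk in the plane starting at the origin and taking unit east, north and south steps, where a north step is never immediately followed or preceded by a south step. A PDSAW in the asymmetric wedge is a PDSAW that stays within the (closed) wedge $\{(x,y): -x\le y\le 0\}$ and ends at some point of the line $y=-x$; with $n$ east steps it therefore ends at $(n,-n)$. Such a walk is determined by the $y$-coordinates of its east steps. The length of the last descent is the number of south steps after the last east step. For a permutation $\sigma$ of $[n]$, the arc $(i,\sigma(i))$ is nested by the arc $(j,\sigma(j))$ if $j<i\le\sigma(i)<\sigma(j)$ or $j>i>\sigma(i)>\sigma(j)$. The number of nestings of $\sigma$ is the number of pairs $(i,j)$ such that $(i,\sigma(i))$ is nested by $(j,\sigma(j))$. A factor of a PDSAW in the asymmetric wedge is a sub-path starting at $(a,-a)$ and ending at $(b,-b)$, for some $a<b$, such that all east steps of the PDSAW after the point $(a,-a)$ are (weakly) below the line $y=-a$, and all east steps of the PDSAW after the point $(b,-b)$ are (weakly) below the line $y=-b$. A factor of a permutation is a sub-permutation on an interval $\{a,a+1,\dots,b\}$ such that all elements less than $a$ are mapped to elements less than $a$, and all elements greater than $b$ are mapped to elements greater than $b$. A factor is prime if it contains no smaller factor. Every PDSAW in the asymmetric wedge, and every permutation, is the concatenation of its consecutive prime factors; the last factor of a PDSAW is its last prime factor and the first factor of a permutation is its first (leftmost) prime factor. *)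

(* Defs.v *)
From HB Require Import structures.
From mathcomp Require Import all_boot all_order all_fingroup all_algebra.

Set Implicit Arguments.
Unset Strict Implicit.
Unset Printing Implicit Defensive.

Import Order.TTheory GRing.Theory Num.Theory.

Local Open Scope ring_scope.

Inductive step := East | North | South.

Definition step_code (s : step) : option bool :=
  match s with East => None | North => Some true | South => Some false end.

Definition step_decode (c : option bool) : step :=
  match c with None => East | Some true => North | Some false => South end.

Lemma step_codeK : cancel step_code step_decode.
Proof. by case. Qed.

HB.instance Definition _ := Finite.copy step (can_type step_codeK).

(* A walk is the word of its steps; hence a sub-path and its translate to the
   origin are the same word. *)

Definition xend (p : seq step) : int := (count_mem East p)%:Z.

Definition yend (p : seq step) : int :=
  (count_mem North p)%:Z - (count_mem South p)%:Z.

Definition endpoint (p : seq step) : int * int := (xend p, yend p).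

Definition reversal (s t : step) : bool :=
  (s == North) && (t == South) || (s == South) && (t == North).

Definition partially_directed_saw (p : seq step) : bool :=
  sorted (fun s t => ~~ reversal s t) p.

Definition in_wedge (z : int * int) : bool := - z.1 <= z.2 <= 0.

Definition wedge_pdsaw (n : nat) (p : seq step) : bool :=
  [&& partially_directed_saw p,
      all (fun k => in_wedge (endpoint (take k p))) (iota 0 (size p).+1),
      yend p == - xend p
    & count_mem East p == n].

Record pdsaw (n : nat) := Pdsaw {
  steps :> seq step;
  stepsP : wedge_pdsaw n steps }.

HB.instance Definition _ (n : nat) := [isSub for @steps n].
HB.instance Definition _ (n : nat) := [Equality of pdsaw n by <:].

Definition north_steps (p : seq step) : nat := count_mem North p.

Definition last_descent (p : seq step) : nat :=
  count_mem South (take (index East (rev p)) (rev p)).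

(* Permutations of {1, ..., n} are encoded as permutations of
   'I_n = {0, ..., n-1}; nestings are invariant under this shift. *)

Definition nested_by n (s : 'S_n) (i j : 'I_n) : bool :=
  [&& j < i, i <= s i & s i < s j]%N || [&& j > i, i > s i & s i > s j]%N.

Definition nestings n (s : 'S_n) : nat :=
  #|[set ij : 'I_n * 'I_n | nested_by s ij.1 ij.2]|.

(* [F a b x] reads: x is the factor that spans from a to b. *)

Definition prime_factor (X : Type) (F : nat -> nat -> X -> Prop)
    (a b : nat) (x : X) : Prop :=
  F a b x /\
  forall a' b' x', F a' b' x' -> (a <= a')%N -> (b' <= b)%N ->
    a' = a /\ b' = b.

(* The members of l, in order, span consecutive pieces that tile [a, n]. *)
Fixpoint consecutive (T : nat -> Type)
    (F : nat -> nat -> {m : nat & T m} -> Prop)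
    (a n : nat) (l : seq {m : nat & T m}) : Prop :=
  if l is x :: l' then
    F a (a + tag x)%N x /\ consecutive F (a + tag x)%N n l'
  else a = n.

(* Every east step of t, when t is walked from the end of s, has y <= c. *)
Definition east_below (c : int) (s t : seq step) : Prop :=
  forall u v, t = u ++ East :: v -> yend (s ++ u) <= c.

Definition walk_factor (p : seq step) (a b : nat) (q : seq step) : Prop :=
  (a < b)%N /\
  exists s t : seq step,
    [/\ p = s ++ q ++ t,
        endpoint s = (a%:Z, - a%:Z),
        endpoint (s ++ q) = (b%:Z, - b%:Z),
        east_below (- a%:Z) s (q ++ t)
      & east_below (- b%:Z) (s ++ q) t].

Definition walk_prime_factors n (P : pdsaw n)
    (l : seq {m : nat & pdsaw m}) : Prop :=
  consecutive
    (fun a b Q => prime_factor (walk_factor P) a b (steps (tagged Q))) 0 n l.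

(* The interval is a <= i < b in the 0-based encoding, and the sub-permutation
   is relabelled by subtracting a. *)
Definition perm_factor n (s : 'S_n) (a b : nat)
    (t : {m : nat & 'S_m}) : Prop :=
  [/\ (a < b <= n)%N /\ (b = a + tag t)%N,
      forall i : 'I_n, (i < a)%N -> (s i < a)%N,
      forall i : 'I_n, (b <= i)%N -> (b <= s i)%N
    & forall (i : 'I_n) (j : 'I_(tag t)),
        i = (a + j)%N :> nat -> s i = (a + tagged t j)%N :> nat].

Definition perm_prime_factors n (s : 'S_n)
    (l : seq {m : nat & 'S_m}) : Prop :=
  consecutive (prime_factor (perm_factor s)) 0 n l.

(* Main.v *)
Require Import Defs.
From HB Require Import structures.
From mathcomp Require Import all_boot all_order all_fingroup all_algebra.
From mathcomp Require Import zify ring.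

Set Implicit Arguments.
Unset Strict Implicit.
Unset Printing Implicit Defensive.

Import Order.TTheory GRing.Theory Num.Theory.

(* Proof idea.  Encode a walk by the depths [h_0, ..., h_(n-1)] of its east
   steps, so that [h_i <= i], and a permutation by its one-line word.  In both
   encodings concatenating factors is the direct sum
   [u ++ (size u + v)], and words factor uniquely into indecomposable ones.
   Any statistic-preserving bijection between indecomposable words therefore
   extends to one that reverses the order of the factors, and it is enough to
   count: if [r_n(k)] is the generating function, by the power of [x], of the
   north steps (resp. nestings) over the objects whose last descent (resp. first
   value) is [k + 1], then both families satisfy
       r_(n+1)(k) = sum_(j < n) x^max(0, k - 1 - j) r_n(j).
   For walks, [j] records the penultimate east step.  For permutations, reading
   the indices from left to right and contracting each arc once both its ends
   are read gives [r_n(k) = (Y^k X^(n-1-k) delta_0)(0)] for two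
   tridiagonal operators with q-integer entries; the recurrence then follows from
   [Y = X + (x - 1) C] and [Y C = x C X + X], where [C] is the part of [X] that
   closes a strict excedance. *)

(** * Direct sums of words and their unique factorisation *)

Definition shift (a : nat) (s : seq nat) : seq nat := map (addn a) s.

Definition dsum (u v : seq nat) : seq nat := u ++ shift (size u) v.

Definition dsums : seq (seq nat) -> seq nat := foldr dsum [::].

(** This is the condition for splitting [s] as a direct sum at position [a]. The prefix is left
    free: its letters are bounded automatically in a depth word, and by counting in a permutation
    word ([perm_seq_dsum]). *)
Definition cut (a : nat) (s : seq nat) := all (leq a) (drop a s).

Definition indec (s : seq nat) :=
  (s != [::]) && all (fun a => ~~ cut a s) (iota 1 (size s).-1).

Lemma size_shift a s : size (shift a s) = size s.
Proof. exact: size_map. Qed.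

Lemma shift_cat a u v : shift a (u ++ v) = shift a u ++ shift a v.
Proof. exact: map_cat. Qed.

Lemma shift_shift a b s : shift a (shift b s) = shift (a + b) s.
Proof. by rewrite /shift -map_comp; apply: eq_map => x /=; rewrite addnA. Qed.

Lemma shift0 s : shift 0 s = s.
Proof. exact: map_id. Qed.

Lemma shift_inj a : injective (shift a).
Proof. exact/inj_map/addnI. Qed.

Lemma all_leq_shift a s : all (leq a) (shift a s).
Proof. by rewrite all_map; apply/allP => /= x _; rewrite leq_addr. Qed.

Lemma shift_subK a s : all (leq a) s -> shift a (map (subn^~ a) s) = s.
Proof.
move=> /allP as_; rewrite /shift -map_comp map_id_in // => /= x /as_.
by move=> ax; rewrite subnKC.
Qed.

Lemma size_dsum u v : size (dsum u v) = size u + size v.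
Proof. by rewrite size_cat size_shift. Qed.

Lemma dsum0s s : dsum [::] s = s.
Proof. exact: shift0. Qed.

Lemma dsums0 s : dsum s [::] = s.
Proof. exact: cats0. Qed.

Lemma dsumA : associative dsum.
Proof.
move=> u v w.
by rewrite /dsum shift_cat shift_shift catA size_cat size_shift.
Qed.

Lemma dsums_cat l1 l2 : dsums (l1 ++ l2) = dsum (dsums l1) (dsums l2).
Proof.
by elim: l1 => [|s l IHl] /=; rewrite ?dsum0s // IHl dsumA.
Qed.

Lemma dsums1 s : dsums [:: s] = s.
Proof. exact: dsums0. Qed.

Lemma size_dsums l : size (dsums l) = sumn (map size l).
Proof. by elim: l => //= s l IHl; rewrite size_dsum IHl. Qed.

Lemma dsum_cut a s : cut a s ->
  s = dsum (take a s) (map (subn^~ a) (drop a s)).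
Proof.
move=> cas; rewrite /dsum size_take; case: ltnP => [_|sa].
  by rewrite shift_subK // cat_take_drop.
by rewrite drop_oversize // take_oversize // cats0.
Qed.

Lemma cut_size s : cut (size s) s.
Proof. by rewrite /cut drop_size. Qed.

Lemma cut_prefix a u v : a <= size u -> cut a (u ++ v) -> cut a u.
Proof.
rewrite leq_eqVlt => /predU1P[->|au]; first by rewrite cut_size.
by rewrite /cut drop_cat au all_cat => /andP[].
Qed.

Lemma cut_dsum_l u v : cut (size u) (dsum u v).
Proof. by rewrite /cut drop_size_cat // all_leq_shift. Qed.

Lemma cut_dsum_shift a u v : cut (size u + a) (dsum u v) = cut a v.
Proof.
rewrite /cut /dsum drop_cat ltnNge leq_addr /= addKn -map_drop all_map.
by apply: eq_all => x /=; rewrite leq_add2l.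
Qed.

Lemma indecP s a : indec s -> 0 < a < size s -> ~~ cut a s.
Proof.
case/andP=> _ /allP ns /andP[a0 as_]; apply: ns.
by rewrite mem_iota a0; lia.
Qed.

Lemma indec_size s : indec s -> 0 < size s.
Proof. by case/andP; case: s. Qed.

(** If the first pieces had different sizes, the smaller size would be a proper cut of the longer
    piece, which is indecomposable. Equal sizes then let the concatenations be compared
    blockwise. *)
Lemma dsum_indec_inj p u q v : indec p -> indec q ->
  dsum p u = dsum q v -> p = q /\ u = v.
Proof.
have half p' u' q' v' : indec p' -> indec q' ->
    dsum p' u' = dsum q' v' -> size p' >= size q'.
  move=> ip iq e; rewrite leqNgt; apply/negP => lt_pq.
  have /negP[] := indecP iq (introT andP (conj (indec_size ip) lt_pq)).
  apply: (@cut_prefix _ _ (shift (size q') v')); rewrite 1?ltnW //.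
  by rewrite -[X in cut _ X]e cut_dsum_l.
move=> ip iq e.
have eqs : size p = size q.
  by apply/eqP; rewrite eqn_leq (half _ _ _ _ iq ip (esym e))
    (half _ _ _ _ ip iq e).
have /eqP := e; rewrite /dsum eqseq_cat // => /andP[/eqP epq /eqP].
by rewrite eqs => /shift_inj.
Qed.

Lemma dsums_inj l l' : all indec l -> all indec l' ->
  dsums l = dsums l' -> l = l'.
Proof.
have nil_l k : all indec k -> dsums k = [::] -> k = [::].
  case: k => //= s k /andP[/indec_size s0 _] /(congr1 size).
  by move=> /eqP; rewrite size_dsum addn_eq0 -leqn0 leqNgt s0.
elim: l l' => [|p l IHl] [|q l'] // il il' e.
- by rewrite (nil_l (q :: l')).
- by rewrite (nil_l (p :: l)).
move: il il' e => /= /andP[ip il] /andP[iq il'].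
by move=> /(dsum_indec_inj ip iq)[-> /IHl->].
Qed.

Definition first_cut (s : seq nat) := (find (cut^~ s) (iota 1 (size s))).+1.

Lemma first_cutP (s : seq nat) : s != [::] ->
  [/\ first_cut s <= size s, cut (first_cut s) s & indec (take (first_cut s) s)].
Proof.
move=> s0; have ss : 0 < size s by case: s s0.
have hs : has (cut^~ s) (iota 1 (size s)).
  by apply/hasP; exists (size s); rewrite ?cut_size // mem_iota; lia.
have lt := hs; rewrite has_find size_iota in lt.
have cs := nth_find 0 hs; rewrite nth_iota // add1n in cs.
split=> //; have sz : size (take (first_cut s) s) = first_cut s.
  by rewrite size_takel.
apply/andP; split; first by rewrite -size_eq0 sz.
apply/allP => /= a; rewrite sz mem_iota => /andP[a0 aF].
have aF' : a < first_cut s by move: aF; rewrite /first_cut; lia.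
have aF'' : a.-1 < find (cut^~ s) (iota 1 (size s)).
  by move: aF'; rewrite /first_cut; lia.
have := before_find 0 aF''; rewrite nth_iota; last by lia.
(* A cut [a] of the prefix is a cut of [s], because the letters after the prefix are at least
   [first_cut s > a]; this contradicts minimality. *)
rewrite add1n prednK // => /negbT; apply: contra => ca.
rewrite /cut -(cat_take_drop (first_cut s) s) drop_cat sz aF' all_cat.
rewrite [X in X && _]ca; apply: sub_all cs => x /=.
exact/leq_trans/ltnW.
Qed.

(** [m] is fuel: each round removes at least one letter, so [size s] rounds suffice. *)
Fixpoint decomp_rec m (s : seq nat) : seq (seq nat) :=
  if m is m'.+1 then
    if s == [::] then [::]
    else take (first_cut s) s ::
         decomp_rec m' (map (subn^~ (first_cut s)) (drop (first_cut s) s))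
  else [::].

Definition decomp s := decomp_rec (size s) s.

Lemma decomp_recP m s : size s <= m ->
  dsums (decomp_rec m s) = s /\ all indec (decomp_rec m s).
Proof.
elim: m s => [|m IHm] s sm /=; first by case: s sm.
case: eqVneq => [-> //|s0] /=.
have [le_c cc ic] := first_cutP s0.
have [|e ->] := IHm (map (subn^~ (first_cut s)) (drop (first_cut s) s)).
  by rewrite size_map size_drop /first_cut; lia.
by rewrite e ic -dsum_cut.
Qed.

Lemma decompK s : dsums (decomp s) = s.
Proof. by case: (decomp_recP (leqnn (size s))). Qed.

Lemma decomp_indec s : all indec (decomp s).
Proof. by case: (decomp_recP (leqnn (size s))). Qed.

Lemma dsumsK l : all indec l -> decomp (dsums l) = l.
Proof. by move=> il; apply: dsums_inj; rewrite ?decompK ?decomp_indec. Qed.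

(** * Permutations counted by nestings and first value *)

Section LiftPerm.

Variable n : nat.
Implicit Types (i j : 'I_n.+1) (s : 'S_n.+1).

(** Deletes the arc leaving [i]. The default [k] is never returned, since [s (lift i k)] differs
    from [s i] by injectivity. *)
Definition unlift_perm_fun i s (k : 'I_n) := odflt k (unlift (s i) (s (lift i k))).

Lemma lift_unlift_perm i s k : lift (s i) (unlift_perm_fun i s k) = s (lift i k).
Proof.
rewrite /unlift_perm_fun; case: unliftP => [//|/perm_inj /esym /eqP].
by rewrite (negPf (neq_lift _ _)).
Qed.

Lemma unlift_perm_inj i s : injective (unlift_perm_fun i s).
Proof.
move=> k l /(congr1 (lift (s i))); rewrite !lift_unlift_perm => /perm_inj.
exact: lift_inj.
Qed.

Lemma big_lift_perm (V : nmodType) i j (P : pred 'S_n.+1) (F : 'S_n.+1 -> V) :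
  (\sum_(s | P s && (s i == j)) F s =
   \sum_(t : 'S_n | P (lift_perm i j t)) F (lift_perm i j t))%R.
Proof.
rewrite (reindex (lift_perm i j)) => [|].
  by apply: eq_bigl => t; rewrite lift_perm_id eqxx andbT.
exists (fun s => perm (@unlift_perm_inj i s)) => [t _|s /andP[_ /eqP sij]].
  apply/permP => k; apply: (@lift_inj _ j); rewrite permE.
  have := lift_unlift_perm i (lift_perm i j t) k.
  by rewrite lift_perm_id lift_perm_lift.
apply/permP => k; case: (unliftP i k) => [l|] ->; rewrite ?lift_perm_id //.
by rewrite lift_perm_lift -sij permE lift_unlift_perm.
Qed.

End LiftPerm.

Lemma nestingsE n (s : 'S_n) :
  nestings s = \sum_(i < n) \sum_(j < n) nested_by s i j.
Proof.
rewrite pair_big /= /nestings -sum1_card big_mkcond /=.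
by apply: eq_bigr => -[i j] _; rewrite inE /=; case: nested_by.
Qed.

Lemma leq_lift n (i : 'I_n) (p q : 'I_n.-1) : (lift i p <= lift i q) = (p <= q).
Proof. by rewrite /= leq_bump2. Qed.

Lemma ltn_lift2 n (i : 'I_n) (p q : 'I_n.-1) : (lift i p < lift i q) = (p < q).
Proof. by rewrite !ltnNge leq_lift. Qed.

(** Nesting depends only on the relative orders of positions and of values and on which arcs are
    weak excedances. The first hypothesis keeps the latter unchanged by the insertion, the second
    says that the inserted arc nests no other, and [c] counts the arcs that nest it. *)
Lemma nestings_lift_perm n (i j : 'I_n.+1) (s : 'S_n) c :
    (forall p : 'I_n, (lift i p <= lift j (s p)) = (p <= s p)) ->
    (forall p, ~~ nested_by (lift_perm i j s) (lift i p) i) ->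
    \sum_(q < n) nested_by (lift_perm i j s) i (lift i q) = c ->
  nestings (lift_perm i j s) = c + nestings s.
Proof.
move=> st no_out <-; rewrite !nestingsE (bigD1_ord i) //=.
rewrite (bigD1_ord i) //= {1}/nested_by !ltnn add0n.
congr (_ + _); apply: eq_bigr => p _.
rewrite (bigD1_ord i) //= (negPf (no_out p)) add0n; apply: eq_bigr => q _.
congr (nat_of_bool _).
by rewrite /nested_by !lift_perm_lift !ltn_lift2 (ltnNge _ (lift i p)) st -ltnNge.
Qed.

Lemma sum_ord_ltn n c : c <= n -> \sum_(q < n) (q < c) = c.
Proof.
move=> cn; have e : \sum_(q < c) 1 = c by rewrite sum1_card card_ord.
rewrite -[RHS]e (big_ord_widen _ (fun=> 1) cn) [RHS]big_mkcond /=.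
apply: eq_bigr => q _. by case: (q < c).
Qed.

(* The situation when the positions below [a] and the values below [b] have been
   read and the arcs with both ends read have been contracted: the positions
   below [a] and the values below [b] are those that are still unmatched. *)
Definition opened n a b (s : 'S_n) := [forall i : 'I_n, (i < a) ==> (b <= s i)].

Lemma openedP n a b (s : 'S_n) :
  reflect (forall i : 'I_n, i < a -> b <= s i) (opened a b s).
Proof. by apply: (iffP forallP) => op i; apply/implyP/op. Qed.

Definition open_sum n a b (Q : pred 'S_n) : {poly int} :=
  (\sum_(s : 'S_n | opened a b s && Q s) 'X^(nestings s))%R.

Lemma opened_lift_pos n h (v : 'I_n.+1) (i : 'I_n.+1) (s : 'S_n) :
  i = h :> nat -> v < h -> opened h h (lift_perm i v s) = opened h h.-1 s.
Proof.
move=> ih vh; apply/openedP/openedP => op p ph.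
  have := op (lift i p); rewrite lift_perm_lift /= /bump ih.
  lia.
move: ph; case: (unliftP i p) => [q|] ->; last by rewrite ih ltnn.
rewrite lift_perm_lift /= /bump ih => ph; have := op q; lia.
Qed.

(* The contracted arc leaves position [h] for the value [v]; it is nested exactly
   by the arcs that will end at the [v] smaller unmatched values. *)
Lemma nestings_lift_pos n h (i v : 'I_n.+1) (s : 'S_n) :
    i = h :> nat -> v < h -> opened h h.-1 s ->
  nestings (lift_perm i v s) = v + nestings s.
Proof.
move=> ih vh /openedP op; apply: nestings_lift_perm => [p|p|].
- by have := op p; rewrite /= /bump ih; lia.
- rewrite /nested_by lift_perm_lift lift_perm_id /= /bump ih.
  by have := op p; lia.
have vn : v <= n by rewrite -ltnS.
(* The nesting arcs are singled out by their values below [v], so the count is reindexed along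
   [s]. *)
rewrite -[RHS](sum_ord_ltn vn) [RHS](reindex_inj (@perm_inj _ s)) /=.
apply: eq_bigr => q _; congr (nat_of_bool _).
rewrite /nested_by lift_perm_lift lift_perm_id /= /bump ih.
by have := op q; lia.
Qed.

Lemma opened_lift_val n b (c : 'I_n.+1) (j : 'I_n.+1) (s : 'S_n) :
  j = b :> nat -> c <= b -> opened b.+1 b (lift_perm c j s) = opened b b s.
Proof.
move=> jb cb; apply/openedP/openedP => op p pb.
  have := op (lift c p); rewrite lift_perm_lift /= /bump jb; lia.
move: pb; case: (unliftP c p) => [q|] ->; last by rewrite lift_perm_id jb.
rewrite lift_perm_lift /= /bump jb => pb; have := op q; lia.
Qed.

(** The contracted arc is a weak excedance from the unmatched position [c] to the value [b]. It is
    nested exactly by the arcs from the [c] unmatched positions on its left, all of which end beyond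
    [b]. *)
Lemma nestings_lift_val n b (c j : 'I_n.+1) (s : 'S_n) :
    j = b :> nat -> c <= b -> opened b b s ->
  nestings (lift_perm c j s) = c + nestings s.
Proof.
move=> jb cb /openedP op; apply: nestings_lift_perm => [p|p|].
- by have := op p; rewrite /= /bump jb; lia.
- rewrite /nested_by lift_perm_lift lift_perm_id /= /bump jb.
  by have := op p; lia.
have cn : c <= n by rewrite -ltnS.
rewrite -[RHS](sum_ord_ltn cn).
apply: eq_bigr => q _; congr (nat_of_bool _).
rewrite /nested_by lift_perm_lift lift_perm_id /= /bump jb.
by have := op q; lia.
Qed.

(** * Reading one more position or one more value *)

Section OpenSumRec.

Local Open Scope ring_scope.

(** Position [h] is read: either its value is still unread and it joins the unmatched positions, or
    it takes one of the [h] unmatched values [v], and contracting that arc yields the factor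
    ['X^v]. *)
Lemma open_sum_pos n h (Q : pred 'S_n.+1) : (h <= n)%N ->
  open_sum h h Q = open_sum h.+1 h Q +
    \sum_(v < h) 'X^v * open_sum h h.-1
                 (fun s : 'S_n => Q (lift_perm (inord h) (inord v) s)).
Proof.
move=> hn; pose i : 'I_n.+1 := inord h.
have ih : i = h :> nat by rewrite inordK.
rewrite /open_sum (bigID (fun s : 'S_n.+1 => h <= s i)%N) /=; congr (_ + _).
  apply: eq_bigl => s; rewrite andbAC; congr (_ && _).
  apply/andP/openedP => [[/openedP op hi] p|op].
    by rewrite ltnS leq_eqVlt => /predU1P[ph|/op//]; rewrite (_ : p = i) //;
      apply: ord_inj; rewrite ph ih.
  split; last by apply: op; rewrite ih.
  by apply/openedP => p ph; apply: op; apply: ltnW.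
rewrite (partition_big (fun s : 'S_n.+1 => s i) (fun v => v < h)%N) /=; last first.
  by move=> s /andP[_]; rewrite -ltnNge.
rewrite (big_ord_widen n.+1 (fun v => 'X^v * open_sum h h.-1
  (fun s : 'S_n => Q (lift_perm (inord h) (inord v) s)))); last by rewrite ltnW.
apply: eq_bigr => v vh; rewrite inord_val big_lift_perm /open_sum big_distrr /=.
apply: eq_big => [s|s].
  by rewrite (opened_lift_pos _ ih vh) lift_perm_id -ltnNge vh andbT.
rewrite (opened_lift_pos _ ih vh) => /andP[/andP[op _] _].
by rewrite (nestings_lift_pos ih vh op) exprD.
Qed.

(** Dually, value [b] either comes from an unread position and becomes unmatched, or comes from one
    of the [b.+1] unmatched positions [c], the one just read included. *)
Lemma open_sum_val n b (Q : pred 'S_n.+1) : (b <= n)%N ->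
  open_sum b.+1 b Q = open_sum b.+1 b.+1 Q +
    \sum_(c < b.+1) 'X^c * open_sum b b
                 (fun s : 'S_n => Q (lift_perm (inord c) (inord b) s)).
Proof.
move=> bn; pose j : 'I_n.+1 := inord b.
have jb : j = b :> nat by rewrite inordK.
rewrite /open_sum (bigID (fun s : 'S_n.+1 => b < (s^-1)%g j)%N) /=; congr (_ + _).
  apply: eq_bigl => s; rewrite andbAC; congr (_ && _).
  apply/andP/openedP => [[/openedP op bj] p pb|op].
    rewrite ltn_neqAle op // andbT; apply/eqP => bp.
    have pj : p = (s^-1)%g j.
      by apply: (perm_inj (s := s)); rewrite permKV; apply: ord_inj; rewrite jb.
    by move: pb; rewrite pj ltnS leqNgt bj.
  split; first by apply/openedP => p /op; apply: ltnW.
  rewrite ltnNge -ltnS; apply/negP => /op.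
  by rewrite permKV jb ltnn.
rewrite (partition_big (fun s : 'S_n.+1 => (s^-1)%g j)
                       (fun c => c < b.+1)%N) /=; last first.
  by move=> s /andP[_]; rewrite -leqNgt.
rewrite (big_ord_widen n.+1 (fun c => 'X^c * open_sum b b
  (fun s : 'S_n => Q (lift_perm (inord c) (inord b) s)))); last by [].
apply: eq_bigr => c cb; have cb' : (c <= b)%N := cb; rewrite inord_val.
rewrite (eq_bigl (fun s : 'S_n.+1 =>
    [&& opened b.+1 b s && Q s & ~~ (b < c)%N] && (s c == j))); last first.
  move=> s; rewrite -(inj_eq (@perm_inj _ s)) permKV (eq_sym j).
  by case: (s c =P j) => [<-|]; rewrite ?andbF // permK.
rewrite big_lift_perm /open_sum big_distrr /=.
apply: eq_big => [s|s].
  by rewrite (opened_lift_val _ jb cb) -leqNgt cb' andbT.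
rewrite (opened_lift_val _ jb cb) => /andP[/andP[op _] _].
by rewrite (nestings_lift_val jb cb op) exprD.
Qed.

End OpenSumRec.

(** Quantifying over the index makes sense in ['S_0] too, and a plain number [w] can be renumbered
    when an arc is contracted. *)
Definition starts w n (s : 'S_n) :=
  [exists i : 'I_n, (i == 0 :> nat) && (s i == w :> nat)].

Lemma starts_lift (w n : nat) (i j : 'I_n.+1) (s : 'S_n) : 0 < i -> w != j ->
  starts w (lift_perm i j s) = starts (unbump j w) s.
Proof.
move=> i0 wj; apply/existsP/existsP => -[p /andP[/eqP p0 /eqP sp]].
  move: p0 sp; case: (unliftP i p) => [q|] ->; last lia.
  rewrite lift_perm_lift /= => p0 sp; exists q; rewrite -sp bumpK eqxx andbT.
  by move: p0; rewrite /bump; lia.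
exists (lift i p); rewrite lift_perm_lift /= sp p0 /bump leqNgt i0 /=.
by rewrite -[X in X == _]/(bump j (unbump j w)) unbumpKcond eq_sym (negPf wj).
Qed.

Lemma starts_lift_val (w n : nat) (i j : 'I_n.+1) (s : 'S_n) : w = j ->
  starts w (lift_perm i j s) = (i == 0 :> nat).
Proof.
move=> ->; apply/existsP/eqP => [[p /andP[/eqP p0 /eqP/ord_inj sp]]|i0].
  rewrite -p0; congr nat_of_ord.
  by apply/esym/(perm_inj (s := lift_perm i j s)); rewrite sp lift_perm_id.
by exists i; rewrite i0 lift_perm_id !eqxx.
Qed.

(** * Transfer operators and the recurrence for permutations *)

Section TransferOperators.

Local Open Scope ring_scope.

Definition qnat h : {poly int} := \sum_(i < h) 'X^i.

Lemma qnat0 : qnat 0 = 0. Proof. exact: big_ord0. Qed.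

Lemma qnatS h : qnat h.+1 = 1 + 'X * qnat h.
Proof.
rewrite /qnat big_ord_recl big_distrr; congr (_ + _).
by apply: eq_bigr => i _ /=; rewrite exprS.
Qed.

(** [m] values remain to be read. The even states come after both the position and the value of an
    index, the odd ones between the two. In the [_starts] versions the first position is still
    unmatched and its arc must end at the value reached after [k] further ones. *)
Definition even_sum m h := open_sum h h (fun _ : 'S_(h + m) => true).
Definition odd_sum m b := open_sum b.+1 b (fun _ : 'S_(b + m) => true).
Definition even_starts m h k := open_sum h h (@starts (h + k) (h + m)).
Definition odd_starts m b k := open_sum b.+1 b (@starts (b + k) (b + m)).

Lemma eq_open_sum n a b (P Q : pred 'S_n) :
  (forall s, opened a b s -> P s = Q s) -> open_sum a b P = open_sum a b Q.
Proof.
move=> PQ; apply: eq_bigl => s; case op: (opened a b s) => //=.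
exact: PQ op.
Qed.

Lemma open_sum0 n a b (P : pred 'S_n) :
  (forall s, opened a b s -> P s = false) -> open_sum a b P = 0.
Proof. by move=> P0; apply: big1 => s /andP[/P0->]. Qed.

Lemma even_sum0 h : even_sum 0 h = (h == 0)%:R.
Proof.
rewrite /even_sum addn0; case: h => [|h].
  rewrite /open_sum (big_pred1 1%g) => [|s].
    by rewrite nestingsE big_ord0.
  rewrite andbT; transitivity true; last first.
    by apply/esym/eqP/permP => -[].
  by apply/openedP => -[].
apply: big1 => s /andP[/openedP /(_ ord0 isT)].
by rewrite leqNgt ltn_ord.
Qed.

Lemma even_sumS m h :
  even_sum m.+1 h = odd_sum m.+1 h + qnat h * odd_sum m.+1 h.-1.
Proof.
rewrite /even_sum /odd_sum !addnS open_sum_pos ?leq_addr // big_distrl.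
by case: h => [|h]; rewrite ?big_ord0 //= addSn.
Qed.

Lemma odd_sumS m b :
  odd_sum m.+1 b = even_sum m b.+1 + qnat b.+1 * even_sum m b.
Proof.
rewrite /even_sum /odd_sum addnS open_sum_val ?leq_addr //.
by rewrite big_distrl addSn.
Qed.

(** With [0 < h] the position read is not the first one, so the marked arc is not contracted
    here. *)
Lemma even_startsS m h k : (0 < h)%N ->
  even_starts m.+1 h k = odd_starts m.+1 h k + qnat h * odd_starts m.+1 h.-1 k.
Proof.
case: h => // h _.
rewrite /even_starts /odd_starts !addnS open_sum_pos ?leq_addr // big_distrl.
congr (_ + _); apply: eq_bigr => v _; congr (_ * _); rewrite !addSn.
apply: eq_open_sum => s _.
have hn : (h.+1 < (h + m).+2)%N by rewrite !ltnS leq_addr.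
have vh : (v < h.+1)%N := ltn_ord v.
rewrite starts_lift !inordK //; try lia.
by have -> : unbump v (h + k).+1 = (h + k)%N by rewrite /unbump; lia.
Qed.

(** The value being read is the end of the marked arc, so among the contractions only [c = 0]
    survives; it has weight 1 and leaves an unmarked state. *)
Lemma odd_starts0 m b : odd_starts m.+1 b 0 = even_sum m b.
Proof.
rewrite /odd_starts /even_sum addnS addn0 open_sum_val ?leq_addr //.
have bn : (b < (b + m).+1)%N by rewrite ltnS leq_addr.
rewrite open_sum0 => [|s /openedP op]; last first.
  apply/existsP => -[i /andP[/eqP i0 /eqP si]].
  by have := op i; rewrite i0 si ltnn => /(_ isT).
rewrite add0r big_ord_recl big1 => [|i _].
  rewrite addr0 mul1r; apply: eq_open_sum => s _.
  by rewrite starts_lift_val inordK.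
rewrite open_sum0 ?mulr0 // => s _.
have ib : (i < b)%N := ltn_ord i.
have ibm : (bump 0 i < (b + m).+1)%N by rewrite /bump /=; lia.
by rewrite starts_lift_val !inordK.
Qed.

(** The first position is reserved for a later value, so the term [c = 0] vanishes and the sum over
    the other [c] is ['X * qnat b]. *)
Lemma odd_startsS m b k : odd_starts m.+1 b k.+1 =
  even_starts m b.+1 k + 'X * qnat b * even_starts m b k.
Proof.
rewrite /odd_starts /even_starts addnS open_sum_val ?leq_addr //.
have bn : (b < (b + m).+1)%N by rewrite ltnS leq_addr.
congr (_ + _); first by rewrite addnS.
rewrite big_ord_recl open_sum0 => [|s _]; last first.
  apply/existsP => -[p /andP[/eqP p0 /eqP]].
  have -> : p = inord 0 by apply: ord_inj; rewrite inordK.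
  by rewrite lift_perm_id inordK //; lia.
rewrite mulr0 add0r -mulrA /qnat big_distrl big_distrr /=.
apply: eq_bigr => c _; rewrite mulrA -exprS; congr (_ * _).
apply: eq_open_sum => s _; have cb : (c < b)%N := ltn_ord c.
have cbm : (bump 0 c < (b + m).+1)%N by rewrite /bump /=; lia.
rewrite starts_lift !inordK //; last by lia.
by rewrite (_ : unbump b (b + k.+1) = (b + k)%N) // /unbump; lia.
Qed.

(* [transfer] reads one index when [h] positions and [h] values are unmatched.
   [marked_transfer] keeps the arc that leaves the first position open; here [h]
   does not count that arc, whence the extra factor ['X]: the open arc nests
   every upper arc closed before it.  [closing] keeps the terms of [transfer] in
   which the value read is a strict excedance. *)
Definition transfer (f : nat -> {poly int}) h :=
  f h.+1 + (qnat h + qnat h.+1) * f h + qnat h ^+ 2 * f h.-1.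

Definition marked_transfer (f : nat -> {poly int}) h :=
  f h.+1 + ('X * qnat h + qnat h.+1) * f h + 'X * qnat h ^+ 2 * f h.-1.

Definition closing (f : nat -> {poly int}) h :=
  qnat h * f h + qnat h ^+ 2 * f h.-1.

Lemma even_sum_transfer m h : even_sum m.+1 h = transfer (even_sum m) h.
Proof.
rewrite even_sumS !odd_sumS /transfer; case: h => [|h] /=; last ring.
rewrite qnat0; ring.
Qed.

(** A value followed by a position, read while the marked arc is open, is one [marked_transfer];
    after [k] of them the marked arc closes and [even_sum] remains. *)
Lemma odd_starts_transfer m b k : (k <= m)%N ->
  odd_starts m.+1 b k = iter k marked_transfer (even_sum (m - k)) b.
Proof.
elim: k m b => [|k IHk] m b km; first by rewrite subn0 odd_starts0.
case: m km => // m; rewrite ltnS => km; rewrite odd_startsS even_startsS // subSS.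
(* For [b = 0], which [even_startsS] excludes, the factor [qnat 0] kills both sides. *)
have -> : 'X * qnat b * even_starts m.+1 b k =
  'X * qnat b * (odd_starts m.+1 b k + qnat b * odd_starts m.+1 b.-1 k).
  by case: b => [|b]; [rewrite qnat0; ring | rewrite even_startsS].
rewrite !IHk // iterS /marked_transfer /=; ring.
Qed.

Lemma marked_transferE f h : marked_transfer f h = transfer f h + ('X - 1) * closing f h.
Proof. rewrite /marked_transfer /transfer /closing; ring. Qed.

Lemma marked_transfer_closing f h :
  marked_transfer (closing f) h = 'X * closing (transfer f) h + transfer f h.
Proof.
(* The cases [0] and [1] are separated because the predecessors of [h] are truncated. *)
rewrite /marked_transfer /transfer /closing; case: h => [|[|h]] /=; rewrite !qnatS ?qnat0; ring.
Qed.

Lemma eq_iter_marked k f g : f =1 g -> iter k marked_transfer f =1 iter k marked_transfer g.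
Proof. by elim: k => //= k IHk fg h; rewrite /marked_transfer !IHk. Qed.

Lemma iter_markedD k a f g h :
  iter k marked_transfer (fun i => a * f i + g i) h = a * iter k marked_transfer f h + iter k marked_transfer g h.
Proof.
elim: k f g h => //= k IHk f g h; rewrite /marked_transfer !IHk; ring.
Qed.

(** [opened 1 0], the state after reading the first position alone, holds of every permutation; so
    this is the nesting polynomial of all permutations with first value [k]. *)
Definition start_sum n k := open_sum 1 0 (@starts k n).

Lemma start_sumE n k : (k <= n)%N ->
  start_sum n.+1 k = iter k marked_transfer (even_sum (n - k)) 0.
Proof. exact: (@odd_starts_transfer n 0 k). Qed.

Lemma start_sum0 n : start_sum n.+1 0 = even_sum n 0.
Proof. exact: (odd_starts0 n 0). Qed.

(** In operator form, [(Y^k C X^(n-k) delta_0)(0)]. *)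
Definition closing_sum n k := iter k marked_transfer (closing (even_sum (n - k))) 0.

(** The innermost [Y] of [Y^(k+1) X^(n-1-k)] is replaced by [X + (x - 1) C]. *)
Lemma start_sumS n k : (k < n)%N ->
  start_sum n.+1 k.+1 = start_sum n.+1 k + ('X - 1) * closing_sum n.-1 k.
Proof.
move=> kn; rewrite !start_sumE //; last exact: ltnW.
case: n kn => // n; rewrite ltnS /= => kn; rewrite subSS subSn //.
rewrite -iterS iterSr [RHS]addrC /closing_sum -iter_markedD.
apply: eq_iter_marked => h.
by rewrite marked_transferE addrC; congr (_ + _); rewrite even_sum_transfer.
Qed.

(** The innermost [Y C] of [Y^(k+1) C X^(n-1-k)] is replaced by [x C X + X]. *)
Lemma closing_sumS n k : (k < n)%N ->
  closing_sum n k.+1 = 'X * closing_sum n k + start_sum n.+1 k.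
Proof.
move=> kn; rewrite start_sumE 1?ltnW // /closing_sum.
rewrite iterSr -iter_markedD; apply: eq_iter_marked => h.
have -> : (n - k = (n - k.+1).+1)%N by lia.
rewrite marked_transfer_closing; congr (_ * _ + _); last by rewrite even_sum_transfer.
by rewrite /closing !even_sum_transfer.
Qed.

Lemma closing_sumE n k : (k <= n)%N ->
  closing_sum n k = \sum_(j < k) 'X^(k.-1 - j) * start_sum n.+1 j.
Proof.
elim: k => [|k IHk] kn.
  by rewrite big_ord0 /closing_sum /= /closing qnat0; ring.
rewrite closing_sumS // IHk 1?ltnW // big_ord_recr /= subnn mul1r.
rewrite big_distrr; congr (_ + _); apply: eq_bigr => j _ /=.
rewrite mulrA -exprS; congr ('X^_ * _); have := ltn_ord j; lia.
Qed.

Lemma even_sum_starts n : even_sum n.+1 0 = \sum_(j < n.+1) start_sum n.+1 j.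
Proof.
rewrite /even_sum /start_sum /open_sum.
rewrite (partition_big (fun s : 'S_n.+1 => s ord0) xpredT) //=.
apply: eq_bigr => j _; apply: eq_bigl => s.
have -> : opened 0 0 s by apply/openedP.
have -> : opened 1 0 s by apply/openedP.
apply/eqP/existsP => [<-|[i /andP[/eqP i0 /eqP/ord_inj <-]]].
  by exists ord0; rewrite !eqxx.
by congr (s _); apply: ord_inj.
Qed.

(** From [k] to [k.+1], exactly the terms with [j < k] gain a factor ['X], the other exponents being
    truncated to 0. That gain is the correction [('X - 1) * closing_sum] of [start_sumS]. *)
Lemma start_sum_rec n k : (0 < n)%N -> (k <= n)%N ->
  start_sum n.+1 k = \sum_(j < n) 'X^(k.-1 - j) * start_sum n j.
Proof.
case: n => // n _; elim: k => [|k IHk] kn.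
  rewrite start_sum0 even_sum_starts.
  by apply: eq_bigr => j _; rewrite sub0n mul1r.
rewrite start_sumS // IHk 1?ltnW //= closing_sumE //.
rewrite (@big_ord_widen _ _ _ k n.+1 (fun j => 'X^(k.-1 - j) * start_sum n.+1 j));
  last by rewrite ltnW.
rewrite [X in _ + _ * X]big_mkcond big_distrr -big_split; apply: eq_bigr => j _ /=.
case: ltnP => jk; last by rewrite mulr0 addr0 (_ : k - j = k.-1 - j)%N //; lia.
have -> : (k - j = (k.-1 - j).+1)%N by lia.
rewrite exprS; ring.
Qed.

End TransferOperators.

(** * Reduction to indecomposable words *)

Lemma decomp_dsum_l p u : indec p -> decomp (dsum p u) = p :: decomp u.
Proof.
move=> ip; apply: dsums_inj; rewrite ?decomp_indec //= ?ip ?decomp_indec //.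
by rewrite !decompK.
Qed.

Lemma decomp_dsum_r p u : indec p -> decomp (dsum u p) = rcons (decomp u) p.
Proof.
move=> ip; rewrite -cats1; apply: dsums_inj; rewrite ?decomp_indec //.
  by rewrite all_cat decomp_indec /= ip.
by rewrite dsums_cat /= dsums0 !decompK.
Qed.

Section GradedClass.

Variables (K : pred (seq nat)) (enumK : nat -> seq (seq nat)).
Variables (wt mk : seq nat -> nat) (left_end : bool).

(* The marked piece [p] is the first one of a permutation, but the last one of
   a walk. *)
Definition attach p u := if left_end then dsum p u else dsum u p.

Hypothesis K_dsum : forall u v, K (dsum u v) = K u && K v.
Hypothesis enumK_uniq : forall n, uniq (enumK n).
Hypothesis mem_enumK : forall n (s : seq nat), (s \in enumK n) = (size s == n) && K s.
Hypothesis wt_dsum : forall u v, K u -> K v -> wt (dsum u v) = wt u + wt v.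
Hypothesis mk_attach : forall p u : seq nat, p != [::] -> mk (attach p u) = mk p.

Lemma size_attach p u : size (attach p u) = size p + size u.
Proof. by rewrite /attach; case: left_end; rewrite size_dsum // addnC. Qed.

Lemma K_attach p u : K (attach p u) = K p && K u.
Proof. by rewrite /attach; case: left_end; rewrite K_dsum // andbC. Qed.

Lemma wt_attach p u : K p -> K u -> wt (attach p u) = wt p + wt u.
Proof. by move=> *; rewrite /attach; case: left_end; rewrite wt_dsum // addnC. Qed.

Definition marked_piece s :=
  if left_end then head [::] (decomp s) else last [::] (decomp s).

Lemma marked_piece_attach p u : indec p -> marked_piece (attach p u) = p.
Proof.
move=> ip; rewrite /marked_piece /attach; case: left_end.
  by rewrite decomp_dsum_l.
by rewrite decomp_dsum_r // last_rcons.
Qed.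

Lemma attach_inj p u q v : indec p -> indec q ->
  attach p u = attach q v -> p = q /\ u = v.
Proof.
move=> ip iq e; have epq : p = q.
  by rewrite -(marked_piece_attach u ip) e marked_piece_attach.
split=> //; rewrite {}epq in e *; rewrite -[u]decompK -[v]decompK; congr dsums.
move: (congr1 decomp e); rewrite /attach; case: left_end.
  by rewrite !decomp_dsum_l // => -[].
by rewrite !decomp_dsum_r // => /rcons_inj[].
Qed.

Lemma attachP (s : seq nat) : s != [::] ->
  exists p u, [/\ s = attach p u, indec p & p = marked_piece s].
Proof.
move=> s0; have := decompK s; have := decomp_indec s; rewrite /marked_piece /attach.
have : decomp s != [::] by apply: contraNneq s0 => e; rewrite -(decompK s) e.
case: left_end; first case: (decomp s) => //= p l _ /andP[ip il] <-.
  by exists p, (dsums l).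
case: (lastP (decomp s)) => [|l p] // _; rewrite all_rcons => /andP[ip il] <-.
by exists p, (dsums l); rewrite -cats1 dsums_cat /= dsums0 last_cat.
Qed.

Local Open Scope ring_scope.

Definition gf n : {poly int} := \sum_(s <- enumK n) 'X^(wt s).
Definition mk_gf n k : {poly int} := \sum_(s <- enumK n | mk s == k) 'X^(wt s).
Definition indec_gf n k : {poly int} :=
  \sum_(s <- enumK n | indec s && (mk s == k)) 'X^(wt s).

(** Splitting off the marked piece is invertible: [attachP] gives existence and [attach_inj]
    uniqueness. *)
Lemma perm_enumK n a : (a < n)%N ->
  perm_eq [seq s <- enumK n | size (marked_piece s) == a.+1]
          [seq attach p u | p <- [seq p <- enumK a.+1 | indec p],
                            u <- enumK (n - a.+1)].
Proof.
move=> an; apply: uniq_perm; first exact: filter_uniq.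
  apply: allpairs_uniq; rewrite ?filter_uniq //.
  move=> [p u] [q v] /allpairsP[[p' u'] /= [+ _ [-> ->]]].
  rewrite mem_filter => /andP[ip _] /allpairsP[[q' v'] /= [+ _ [-> ->]]].
  by rewrite mem_filter => /andP[iq _] /(attach_inj ip iq)[-> ->].
move=> /= s; rewrite mem_filter mem_enumK; apply/and3P/allpairsP.
  move=> [/eqP sp /eqP sn Ks].
  have s0 : s != [::] by rewrite -size_eq0 sn; lia.
  have [p [u [es ip ep]]] := attachP s0; exists (p, u); split=> //=.
    rewrite mem_filter ip mem_enumK ep sp eqxx -ep.
    by move: Ks; rewrite es K_attach => /andP[].
  rewrite mem_enumK; move: Ks; rewrite es K_attach => /andP[_ ->].
  by rewrite andbT -sn es size_attach [in size p]ep sp addKn.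
move=> [[p u] /= []]; rewrite mem_filter !mem_enumK.
move=> /and3P[ip /eqP sp Kp] /andP[/eqP su Ku] ->.
rewrite marked_piece_attach // K_attach size_attach sp su Kp Ku eqxx.
by split=> //; lia.
Qed.

(** Sort by the size of the marked piece. The mark depends on that piece alone and weights add, so
    each class contributes a product. *)
Lemma mk_gf_indec n k : (0 < n)%N ->
  mk_gf n k = \sum_(a < n) indec_gf a.+1 k * gf (n - a.+1).
Proof.
move=> n0; transitivity (\sum_(a < n)
    \sum_(s <- enumK n | (mk s == k) && (size (marked_piece s) == a.+1))
      ('X^(wt s) : {poly int})).
  rewrite (exchange_big_dep (fun s => mk s == k)) => [|a s _ /andP[] //] /=.
  rewrite /mk_gf big_seq_cond [RHS]big_seq_cond; apply: eq_bigr => s.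
  rewrite mem_enumK => /andP[/andP[/eqP sn Ks] /eqP ms].
  have s0 : s != [::] by rewrite -size_eq0 sn; lia.
  have [p [u [es ip ep]]] := attachP s0.
  have p0 := indec_size ip.
  have an : ((size p).-1 < n)%N by rewrite -sn es size_attach; lia.
  rewrite (big_pred1 (Ordinal an)) // => a /=; rewrite ms eqxx -ep /=.
  by apply/eqP/eqP => [pa|->]; [apply: ord_inj => /= | rewrite /=]; lia.
apply: eq_bigr => a _; rewrite /indec_gf /gf big_distrl /=.
under eq_bigl do rewrite andbC.
rewrite -big_filter_cond (perm_big _ (perm_enumK (ltn_ord a))) /=.
rewrite -[X in _ = X]big_filter_cond big_mkcond big_allpairs_dep [RHS]big_mkcond /=.
rewrite big_seq [RHS]big_seq.
apply: eq_bigr => p; rewrite mem_filter mem_enumK => /and3P[ip _ Kp].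
have p0 : p != [::] by rewrite -size_eq0 -lt0n indec_size.
case: eqP => mp; last by rewrite big1 // => u _; rewrite mk_attach //; case: eqP.
rewrite big_distrr /= big_seq [RHS]big_seq.
apply: eq_bigr => u; rewrite mem_enumK => /andP[_ Ku].
by rewrite mk_attach // mp eqxx wt_attach // exprD.
Qed.

Hypothesis mk_lt : forall s : seq nat, K s -> s != [::] -> (mk s < size s)%N.

Lemma gf_mk n : (0 < n)%N -> gf n = \sum_(k < n) mk_gf n k.
Proof.
move=> n0; rewrite /mk_gf (exchange_big_dep xpredT) //= /gf big_seq [RHS]big_seq.
apply: eq_bigr => s; rewrite mem_enumK => /andP[/eqP sn Ks].
have s0 : s != [::] by rewrite -size_eq0 sn; lia.
have mn : (mk s < n)%N by rewrite -sn mk_lt.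
by rewrite (big_pred1 (Ordinal mn)).
Qed.

Definition indec_fiber n k m :=
  [seq s <- enumK n | [&& indec s, mk s == k & wt s == m]].

Lemma size_indec_fiber n k m : (size (indec_fiber n k m))%:R = (indec_gf n k)`_m.
Proof.
rewrite /indec_gf coef_sum size_filter -sum1_count natr_sum.
rewrite big_mkcond [RHS]big_mkcond; apply: eq_bigr => s _.
by rewrite coefXn (eq_sym m) andbA; case: (_ && (mk s == k)); case: eqP.
Qed.

End GradedClass.

(** * Walks as depth words *)

(* The words [- y] of the east steps of the walks in the wedge. *)
Definition depth_word (s : seq nat) :=
  all (fun i => nth 0 s i <= i) (iota 0 (size s)).

Lemma depth_wordP (s : seq nat) :
  reflect (forall i, i < size s -> nth 0 s i <= i) (depth_word s).
Proof.
apply: (iffP allP) => /= ds i; first by move=> si; apply: ds; rewrite mem_iota.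
by rewrite mem_iota; apply: ds.
Qed.

Lemma depth_word_cat u v :
  depth_word (u ++ v) = depth_word u &&
    all (fun i => nth 0 v i <= size u + i) (iota 0 (size v)).
Proof.
rewrite /depth_word size_cat iotaD all_cat; congr (_ && _).
  apply: eq_in_all => i; rewrite mem_iota /= add0n => iu.
  by rewrite nth_cat iu.
rewrite -[X in iota X]addn0 iotaDl all_map; apply: eq_all => i /=.
by rewrite nth_cat ltnNge leq_addr /= addKn.
Qed.

Lemma depth_word_rcons (s : seq nat) h :
  depth_word (rcons s h) = depth_word s && (h <= size s).
Proof. by rewrite -cats1 depth_word_cat /= addn0 andbT. Qed.

Lemma depth_word_dsum u v :
  depth_word (dsum u v) = depth_word u && depth_word v.
Proof.
rewrite depth_word_cat size_shift; congr (_ && _); apply: eq_in_all => i.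
rewrite mem_iota /= add0n => iv.
by rewrite (nth_map 0) // leq_add2l.
Qed.

Lemma depth_word_last s : depth_word s -> last 0 s <= (size s).-1.
Proof.
case/lastP: s => [//|s h]; rewrite depth_word_rcons last_rcons size_rcons.
by case/andP.
Qed.

Fixpoint depth_words n : seq (seq nat) :=
  if n is n'.+1 then [seq rcons s h | s <- depth_words n', h <- iota 0 n]
  else [:: [::]].

Lemma depth_wordsS n :
  depth_words n.+1 = [seq rcons s h | s <- depth_words n, h <- iota 0 n.+1].
Proof. by []. Qed.

Lemma mem_depth_words n (s : seq nat) :
  (s \in depth_words n) = (size s == n) && depth_word s.
Proof.
elim: n s => [|n IHn] s; first by rewrite inE; case: s.
apply/allpairsP/idP => [[[t h] []]|].
  rewrite IHn mem_iota add0n => /andP[/eqP tn dt] hn ->.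
  by rewrite size_rcons tn eqxx depth_word_rcons dt tn.
case/lastP: s => [//|s h]; rewrite size_rcons eqSS depth_word_rcons.
move=> /and3P[sn ds hs]; exists (s, h).
by rewrite IHn sn ds mem_iota add0n -(eqP sn).
Qed.

Lemma depth_words_uniq n : uniq (depth_words n).
Proof.
elim: n => // n IHn; apply: allpairs_uniq => //; first exact: iota_uniq.
by move=> [s h] [t k] _ _ /= /rcons_inj[-> ->].
Qed.

(** Counts north steps: truncated subtraction gives [d - h] on a climb from depth [d] to depth [h]
    and [0] on a descent. *)
Fixpoint rises d s := if s is h :: s' then (d - h) + rises h s' else 0.

Lemma rises_cat d s t : rises d (s ++ t) = rises d s + rises (last d s) t.
Proof. by elim: s d => //= h s IHs d; rewrite IHs addnA. Qed.

Lemma rises_shift a d s : rises (a + d) (shift a s) = rises d s.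
Proof. by elim: s d => //= h s IHs d; rewrite IHs subnDl. Qed.

Lemma rises_dsum u v : depth_word u -> depth_word v ->
  rises 0 (dsum u v) = rises 0 u + rises 0 v.
Proof.
move=> du dv; rewrite rises_cat; congr (_ + _).
(* [v] starts with [0], so its shift starts at depth [size u], while [u] ends at depth at most
   [(size u).-1]: no north step arises at the junction. *)
case: v dv => // h v /depth_wordP/(_ 0 isT) /=; rewrite leqn0 => /eqP->.
rewrite rises_shift addn0; congr (_ + _); apply/eqP.
by rewrite subn_eq0; have := depth_word_last du; lia.
Qed.

(** One less than the last descent, to match first values counted from [0]. *)
Definition last_drop s := size s - (last 0 s).+1.

Lemma last_drop_dsum (p u : seq nat) : p != [::] -> last_drop (dsum u p) = last_drop p.
Proof.
case: p => // h p _; rewrite /last_drop size_dsum last_cat /= last_map.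
by rewrite -addnS subnDl.
Qed.

Lemma last_drop_lt (s : seq nat) : s != [::] -> last_drop s < size s.
Proof. case: s => // h s _; rewrite /last_drop /=; lia. Qed.

Section WalkGf.

Local Open Scope ring_scope.

(** Remove the last east step. It lies at depth [n - k], the one before it at depth [n - 1 - j], and
    the truncated difference [k.-1 - j] counts the north steps between them. *)
Lemma walk_gf_rec n k : (0 < n)%N -> (k <= n)%N ->
  mk_gf depth_words (rises 0) last_drop n.+1 k =
  \sum_(j < n) 'X^(k.-1 - j) * mk_gf depth_words (rises 0) last_drop n j.
Proof.
move=> n0 kn; rewrite /mk_gf depth_wordsS big_mkcond big_allpairs_dep.
under [RHS]eq_bigr do rewrite big_distrr.
rewrite [RHS](exchange_big_dep xpredT) //= big_seq [RHS]big_seq.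
apply: eq_bigr => s; rewrite mem_depth_words => /andP[/eqP sn ds].
have s0 : s != [::] by rewrite -size_eq0 sn; lia.
have jn : (last_drop s < n)%N by rewrite -sn last_drop_lt.
rewrite (big_pred1 (Ordinal jn)) // -exprD.
rewrite -[_ :: _]/(iota 0 n.+1) -big_mkcond -big_filter.
have -> : [seq h <- iota 0 n.+1 | last_drop (rcons s h) == k] = [:: (n - k)%N].
  apply: perm_small_eq => //; apply: uniq_perm => //.
    by rewrite filter_uniq // iota_uniq.
  move=> h; rewrite mem_filter mem_iota inE /last_drop size_rcons last_rcons sn.
  rewrite add0n subSS; apply/andP/eqP => /= [[/eqP <- hn]|->]; first by rewrite subKn.
  by rewrite subKn // ltnS leq_subr.
rewrite big_seq1 -cats1 rises_cat addnC; congr ('X^(_ + _)) => /=.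
have := depth_word_last ds; rewrite addn0 /last_drop sn; lia.
Qed.

End WalkGf.

(** * Permutations as words *)

Definition perm_word n (s : 'S_n) : seq nat := [seq val (s i) | i <- enum 'I_n].

Definition perm_seq (t : seq nat) := perm_eq t (iota 0 (size t)).

Lemma size_perm_word n (s : 'S_n) : size (perm_word s) = n.
Proof. by rewrite size_map size_enum_ord. Qed.

Lemma nth_perm_word n (s : 'S_n) (i : 'I_n) : nth 0 (perm_word s) i = s i.
Proof. by rewrite (nth_map i) ?size_enum_ord // nth_ord_enum. Qed.

Lemma perm_word_inj n : injective (@perm_word n).
Proof.
move=> s t e; apply/permP => i; apply: ord_inj.
by rewrite -!nth_perm_word e.
Qed.

Lemma perm_seq_word n (s : 'S_n) : perm_seq (perm_word s).
Proof.
have u : uniq (perm_word s).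
  by rewrite map_inj_uniq ?enum_uniq // => i j /val_inj/perm_inj.
rewrite /perm_seq size_perm_word; apply: uniq_perm => //; first exact: iota_uniq.
apply: (uniq_min_size u _ _).2; last by rewrite size_iota size_perm_word.
by move=> x /mapP[i _ ->]; rewrite mem_iota /=.
Qed.

Lemma perm_seq_lt t i : perm_seq t -> i < size t -> nth 0 t i < size t.
Proof.
move=> pt it; have := mem_nth 0 it.
by rewrite (perm_mem pt) mem_iota.
Qed.

Lemma perm_word_surj n (t : seq nat) : size t = n -> perm_seq t ->
  exists s : 'S_n, perm_word s = t.
Proof.
move=> <- pt; pose f (i : 'I_(size t)) := Ordinal (perm_seq_lt pt (ltn_ord i)).
have f_inj : injective f.
  move=> i j /(congr1 val) /= /eqP; rewrite nth_uniq //.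
    by move=> /eqP; apply: ord_inj.
  by rewrite (perm_uniq pt) iota_uniq.
exists (perm f_inj); apply: (eq_from_nth (x0 := 0)); rewrite size_perm_word // => i it.
by rewrite (nth_perm_word _ (Ordinal it)) permE.
Qed.

(** Conversely, the letters of [shift a v] already account for as many letters at least [a] as there
    are in the interval, so [u] has none. Filtering by [leq a] then separates the two blocks. *)
Lemma perm_seq_dsum u v : perm_seq (dsum u v) = perm_seq u && perm_seq v.
Proof.
rewrite /perm_seq size_dsum iotaD add0n -[X in iota X (size v)]addn0 iotaDl.
set a := size u; set iv := map _ _; rewrite /dsum -/a.
apply/idP/andP => [puv|[pu pv]]; last by rewrite perm_cat // perm_map.
have iv_ge : all (leq a) iv by apply: all_leq_shift.
have iu_lt : all (predC (leq a)) (iota 0 a).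
  by apply/allP => /= x; rewrite mem_iota add0n -ltnNge.
have lt_filter w : all (predC (leq a)) w -> filter (leq a) w = [::].
  by move=> h; apply/eqP; rewrite -size_eq0 size_filter -leqn0 leqNgt -has_count -all_predC.
have u_lt : all (predC (leq a)) u.
  have := seq.permP puv (leq a).
  rewrite !count_cat -[count _ (iota _ _)]size_filter lt_filter //.
  have count_ge w : all (leq a) w -> count (leq a) w = size w.
    by rewrite all_count => /eqP.
  rewrite (count_ge (shift a v)) ?all_leq_shift // (count_ge iv) //.
  rewrite size_shift size_map size_iota => /addIn/eqP.
  by rewrite -leqn0 leqNgt -has_count -all_predC.
have := perm_filter (leq a) puv; have := perm_filter (predC (leq a)) puv.
have ge_filter w : all (leq a) w -> filter (predC (leq a)) w = [::].
  move=> h; apply/eqP; rewrite -size_eq0 size_filter -leqn0 leqNgt -has_count -all_predC.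
  by apply: sub_all h => x /=; rewrite negbK.
rewrite !filter_cat (ge_filter iv) // (ge_filter (shift a v)) ?all_leq_shift // !cats0.
rewrite (all_filterP u_lt) (all_filterP iu_lt) => ->.
rewrite (lt_filter u) // (lt_filter (iota 0 a)) // !cat0s.
rewrite (all_filterP iv_ge) (all_filterP (all_leq_shift a v)).
by rewrite /iv /shift => /(perm_map_inj (@addnI a)).
Qed.

Definition nest_seq (t : seq nat) :=
  let nest i j x y := [&& j < i, i <= x & x < y] || [&& j > i, i > x & x > y] in
  \sum_(i < size t) \sum_(j < size t) nest i j (nth 0 t i) (nth 0 t j).

Lemma nestings_word n (s : 'S_n) : nestings s = nest_seq (perm_word s).
Proof.
rewrite nestingsE /nest_seq size_perm_word.
by apply: eq_bigr => i _; apply: eq_bigr => j _; rewrite !nth_perm_word.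
Qed.

(** Positions and values of [u] all lie below those of the shifted [v], so arcs of different blocks
    are never nested. *)
Lemma nest_seq_dsum u v : perm_seq u -> nest_seq (dsum u v) = nest_seq u + nest_seq v.
Proof.
move=> pu; rewrite /nest_seq size_dsum big_split_ord /=.
have nu i : i < size u -> nth 0 (dsum u v) i = nth 0 u i.
  by move=> iu; rewrite nth_cat iu.
have nv i : i < size v -> nth 0 (dsum u v) (size u + i) = size u + nth 0 v i.
  by move=> iv; rewrite nth_cat ltnNge leq_addr /= addKn (nth_map 0).
congr (_ + _); apply: eq_bigr => i _; rewrite big_split_ord /=.
  rewrite [X in _ + X]big1 ?addn0 => [|j _].
    by apply: eq_bigr => j _; rewrite !nu.
  rewrite nu // nv //; have := perm_seq_lt pu (ltn_ord i); have := ltn_ord i; lia.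
rewrite [X in X + _]big1 ?add0n => [|j _].
  apply: eq_bigr => j _; rewrite !nv //; lia.
rewrite (nu j) // nv //; have := perm_seq_lt pu (ltn_ord j); have := ltn_ord j; lia.
Qed.

Definition perm_words n := [seq perm_word s | s <- enum 'S_n].

Lemma mem_perm_words n (t : seq nat) :
  (t \in perm_words n) = (size t == n) && perm_seq t.
Proof.
apply/mapP/andP => [[s _ ->]|[/eqP tn pt]].
  by rewrite size_perm_word eqxx perm_seq_word.
by have [s <-] := perm_word_surj tn pt; exists s; rewrite ?mem_enum.
Qed.

Lemma perm_words_uniq n : uniq (perm_words n).
Proof. by rewrite map_inj_uniq ?enum_uniq //; apply: perm_word_inj. Qed.

Lemma head_dsum (p u : seq nat) : p != [::] -> head 0 (dsum p u) = head 0 p.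
Proof. by case: p. Qed.

Lemma head_perm_seq_lt (t : seq nat) : perm_seq t -> t != [::] -> head 0 t < size t.
Proof. by move=> pt t0; rewrite -nth0; apply: perm_seq_lt => //; case: t t0 {pt}. Qed.

Section PermGf.

Local Open Scope ring_scope.

Lemma perm_gfE n : gf perm_words nest_seq n = even_sum n 0.
Proof.
rewrite /gf /perm_words big_map big_enum /even_sum /open_sum.
apply: eq_big => s; last by rewrite nestings_word.
by rewrite andbT; apply/esym/openedP.
Qed.

Lemma perm_mk_gfE n k : (0 < n)%N ->
  mk_gf perm_words nest_seq (head 0%N) n k = start_sum n k.
Proof.
case: n => // n _; rewrite /mk_gf /perm_words big_map big_enum_cond /start_sum /open_sum.
apply: eq_big => s; last by rewrite nestings_word.
have -> : opened 1 0 s by apply/openedP.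
rewrite -nth0 (nth_perm_word _ ord0); apply/eqP/existsP => [<-|[i /andP[/eqP i0 /eqP <-]]].
  by exists ord0; rewrite !eqxx.
by congr (nat_of_ord (s _)); apply: ord_inj.
Qed.

End PermGf.

(** * Equidistribution and the bijection on words *)

Local Notation walk_fiber := (indec_fiber depth_words (rises 0) last_drop).
Local Notation perm_fiber := (indec_fiber perm_words nest_seq (head 0)).

Section Equidistribution.

Local Open Scope ring_scope.

Notation walk_gf := (gf depth_words (rises 0)).
Notation walk_mk_gf := (mk_gf depth_words (rises 0) last_drop).
Notation walk_indec_gf := (indec_gf depth_words (rises 0) last_drop).
Notation perm_gf := (gf perm_words nest_seq).
Notation perm_mk_gf := (mk_gf perm_words nest_seq (head 0%N)).
Notation perm_indec_gf := (indec_gf perm_words nest_seq (head 0%N)).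

Lemma mk_gf_eq n k : (k < n)%N -> walk_mk_gf n k = perm_mk_gf n k.
Proof.
elim: n k => // n IHn k; rewrite ltnS => kn.
case: (posnP n) => [n0|n0].
  move: kn; rewrite n0 leqn0 => /eqP->; rewrite perm_mk_gfE // start_sum0 even_sum0.
  by rewrite /mk_gf /= big_cons big_nil addr0.
rewrite walk_gf_rec // perm_mk_gfE // start_sum_rec //.
by apply: eq_bigr => j _; rewrite IHn // perm_mk_gfE.
Qed.

Lemma gf_eq n : walk_gf n = perm_gf n.
Proof.
case: (posnP n) => [->|n0].
  by rewrite perm_gfE even_sum0 /gf /= big_cons big_nil addr0.
rewrite (gf_mk _ mem_depth_words (fun s _ => @last_drop_lt s)) //.
rewrite (gf_mk _ mem_perm_words head_perm_seq_lt) //.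
by apply: eq_bigr => k _; rewrite mk_gf_eq.
Qed.

Lemma walk_mk_gf_indec n k : (0 < n)%N ->
  walk_mk_gf n k = \sum_(a < n) walk_indec_gf a.+1 k * walk_gf (n - a.+1).
Proof.
exact: (mk_gf_indec (left_end := false) depth_word_dsum depth_words_uniq
  mem_depth_words rises_dsum last_drop_dsum).
Qed.

Lemma perm_mk_gf_indec n k : (0 < n)%N ->
  perm_mk_gf n k = \sum_(a < n) perm_indec_gf a.+1 k * perm_gf (n - a.+1).
Proof.
exact: (mk_gf_indec (left_end := true) perm_seq_dsum perm_words_uniq
  mem_perm_words (fun u v pu _ => nest_seq_dsum v pu) head_dsum).
Qed.

Lemma mk_gf_eq_all n k : (0 < n)%N -> walk_mk_gf n k = perm_mk_gf n k.
Proof.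
move=> n0; case: (ltnP k n) => [|nk]; first exact: mk_gf_eq.
rewrite /mk_gf big1_seq => [|s /andP[/eqP ms]]; last first.
  rewrite mem_depth_words => /andP[/eqP sn _]; move: nk.
  by rewrite -ms -sn leqNgt last_drop_lt // -size_eq0 sn -lt0n.
rewrite big1_seq // => s /andP[/eqP ms].
rewrite mem_perm_words => /andP[/eqP sn ps]; move: nk.
by rewrite -ms -sn leqNgt head_perm_seq_lt // -size_eq0 sn -lt0n.
Qed.

(** In the two factorisations the last term is the unknown [indec_gf n.+1 k] times [gf 0 = 1]; by
    induction all the other terms agree and cancel. *)
Lemma indec_gf_eq n k : (0 < n)%N -> walk_indec_gf n k = perm_indec_gf n k.
Proof.
elim/ltn_ind: n => -[//|n] IHn _; have := mk_gf_eq_all k (ltn0Sn n).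
rewrite walk_mk_gf_indec // perm_mk_gf_indec // !big_ord_recr /= subnn.
rewrite !gf_eq [X in X + _ = _](_ : _ =
  \sum_(a < n) perm_indec_gf a.+1 k * perm_gf (n.+1 - a.+1)).
  by rewrite perm_gfE even_sum0 !mulr1 => /addrI.
by apply: eq_bigr => a _; rewrite gf_eq IHn ?ltnS ?ltn_ord.
Qed.

Lemma size_fiber_eq n k m : (0 < n)%N ->
  size (walk_fiber n k m) = size (perm_fiber n k m).
Proof.
move=> n0; apply/eqP; rewrite -(eqr_nat int) !size_indec_fiber.
by rewrite indec_gf_eq.
Qed.

End Equidistribution.

(** * Matching fibers of equal size by rank, and extending the match to all words *)

Section Transport.

Variables (T : eqType) (x0 : T) (A B : seq T).
Hypothesis size_AB : size A = size B.

Definition transport x := nth x0 B (index x A).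

Lemma mem_transport x : x \in A -> transport x \in B.
Proof. by move=> xA; rewrite mem_nth // -size_AB index_mem. Qed.

Lemma index_transport x : uniq B -> x \in A -> index (transport x) B = index x A.
Proof. by move=> uB xA; rewrite index_uniq // -size_AB index_mem. Qed.

End Transport.

Lemma transportK (T : eqType) (x0 : T) (A B : seq T) x : size A = size B ->
  uniq B -> x \in A -> transport x0 B A (transport x0 A B x) = x.
Proof. by move=> sAB uB xA; rewrite /transport index_transport ?nth_index. Qed.

Definition walk_to_perm_indec (s : seq nat) : seq nat :=
  transport [::] (walk_fiber (size s) (last_drop s) (rises 0 s))
                 (perm_fiber (size s) (last_drop s) (rises 0 s)) s.

Definition perm_to_walk_indec (t : seq nat) : seq nat :=
  transport [::] (perm_fiber (size t) (head 0 t) (nest_seq t))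
                 (walk_fiber (size t) (head 0 t) (nest_seq t)) t.

Lemma mem_walk_fiber n k m (s : seq nat) : (s \in walk_fiber n k m) =
  [&& depth_word s, indec s, size s == n, last_drop s == k & rises 0 s == m].
Proof.
rewrite mem_filter mem_depth_words.
by case: depth_word; case: indec; case: eqP; case: eqP; case: eqP.
Qed.

Lemma mem_perm_fiber n k m (s : seq nat) : (s \in perm_fiber n k m) =
  [&& perm_seq s, indec s, size s == n, head 0 s == k & nest_seq s == m].
Proof.
rewrite mem_filter mem_perm_words.
by case: perm_seq; case: indec; case: eqP; case: eqP; case: eqP.
Qed.

Lemma walk_fiber_uniq n k m : uniq (walk_fiber n k m).
Proof. exact/filter_uniq/depth_words_uniq. Qed.

Lemma perm_fiber_uniq n k m : uniq (perm_fiber n k m).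
Proof. exact/filter_uniq/perm_words_uniq. Qed.

Lemma walk_to_perm_indecP s : depth_word s && indec s ->
  let t := walk_to_perm_indec s in
  [/\ perm_seq t && indec t, size t = size s, head 0 t = last_drop s,
      nest_seq t = rises 0 s & perm_to_walk_indec t = s].
Proof.
move=> /andP[ds is_]; have sAB := size_fiber_eq (last_drop s) (rises 0 s) (indec_size is_).
have sA : s \in walk_fiber (size s) (last_drop s) (rises 0 s).
  by rewrite mem_walk_fiber ds is_ !eqxx.
have := mem_transport [::] sAB sA; rewrite -/(walk_to_perm_indec s) mem_perm_fiber /=.
move=> /and5P[pt it /eqP st /eqP ht /eqP nt]; rewrite pt it; split=> //.
by rewrite /perm_to_walk_indec st ht nt transportK // perm_fiber_uniq.
Qed.

Lemma perm_to_walk_indecP t : perm_seq t && indec t ->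
  let s := perm_to_walk_indec t in
  [/\ depth_word s && indec s, size s = size t & walk_to_perm_indec s = t].
Proof.
move=> /andP[pt it]; have sAB := size_fiber_eq (head 0 t) (nest_seq t) (indec_size it).
have tB : t \in perm_fiber (size t) (head 0 t) (nest_seq t).
  by rewrite mem_perm_fiber pt it !eqxx.
have := mem_transport [::] (esym sAB) tB; rewrite -/(perm_to_walk_indec t) mem_walk_fiber /=.
move=> /and5P[ds is_ /eqP st /eqP ht /eqP nt]; rewrite ds is_; split=> //.
by rewrite /walk_to_perm_indec st ht nt transportK // walk_fiber_uniq.
Qed.

Lemma all_dsums (K : pred (seq nat)) l : K [::] ->
  (forall u v, K (dsum u v) = K u && K v) -> K (dsums l) = all K l.
Proof. by move=> K0 KD; elim: l => [|s l IHl] //=; rewrite KD IHl. Qed.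

Lemma sumn_dsums (K : pred (seq nat)) wt l : K [::] -> wt [::] = 0 ->
    (forall u v, K (dsum u v) = K u && K v) ->
    (forall u v, K u -> K v -> wt (dsum u v) = wt u + wt v) ->
  all K l -> wt (dsums l) = sumn (map wt l).
Proof.
move=> K0 wt0 KD wtD; elim: l => [|s l IHl] //= /andP[Ks Kl].
by rewrite wtD ?IHl // all_dsums.
Qed.

Definition walk_to_perm s := dsums (rev (map walk_to_perm_indec (decomp s))).
Definition perm_to_walk t := dsums (rev (map perm_to_walk_indec (decomp t))).

Lemma decomp_depth_word s : depth_word s ->
  all (fun p => depth_word p && indec p) (decomp s).
Proof.
move=> ds; rewrite all_predI decomp_indec andbT.
by rewrite -(all_dsums _ _ depth_word_dsum) // decompK.
Qed.

Lemma decomp_perm_seq t : perm_seq t ->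
  all (fun p => perm_seq p && indec p) (decomp t).
Proof.
move=> pt; rewrite all_predI decomp_indec andbT.
by rewrite -(all_dsums _ _ perm_seq_dsum) // decompK.
Qed.

Lemma decomp_walk_to_perm s : depth_word s ->
  decomp (walk_to_perm s) = rev (map walk_to_perm_indec (decomp s)).
Proof.
move=> /decomp_depth_word ds; apply: dsumsK; rewrite all_rev all_map.
by apply: sub_all ds => p /walk_to_perm_indecP[/andP[]].
Qed.

Lemma decomp_perm_to_walk t : perm_seq t ->
  decomp (perm_to_walk t) = rev (map perm_to_walk_indec (decomp t)).
Proof.
move=> /decomp_perm_seq pt; apply: dsumsK; rewrite all_rev all_map.
by apply: sub_all pt => p /perm_to_walk_indecP[/andP[]].
Qed.

Lemma perm_seq_walk_to_perm s : depth_word s -> perm_seq (walk_to_perm s).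
Proof.
move=> /decomp_depth_word ds; rewrite (all_dsums _ _ perm_seq_dsum) // all_rev all_map.
by apply: sub_all ds => p /walk_to_perm_indecP[/andP[]].
Qed.

Lemma depth_word_perm_to_walk t : perm_seq t -> depth_word (perm_to_walk t).
Proof.
move=> /decomp_perm_seq pt; rewrite (all_dsums _ _ depth_word_dsum) // all_rev all_map.
by apply: sub_all pt => p /perm_to_walk_indecP[/andP[]].
Qed.

Lemma size_walk_to_perm s : depth_word s -> size (walk_to_perm s) = size s.
Proof.
move=> /decomp_depth_word ds.
rewrite -[in RHS](decompK s) !size_dsums map_rev sumn_rev -map_comp.
congr sumn; apply/eq_in_map => p /(allP ds).
by case/walk_to_perm_indecP.
Qed.

Lemma size_perm_to_walk t : perm_seq t -> size (perm_to_walk t) = size t.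
Proof.
move=> /decomp_perm_seq pt.
rewrite -[in RHS](decompK t) !size_dsums map_rev sumn_rev -map_comp.
congr sumn; apply/eq_in_map => p /(allP pt).
by case/perm_to_walk_indecP.
Qed.

Lemma walk_to_permK s : depth_word s -> perm_to_walk (walk_to_perm s) = s.
Proof.
move=> ds; rewrite /perm_to_walk decomp_walk_to_perm // map_rev revK -map_comp.
rewrite map_id_in ?decompK // => p /(allP (decomp_depth_word ds)).
by case/walk_to_perm_indecP.
Qed.

Lemma perm_to_walkK t : perm_seq t -> walk_to_perm (perm_to_walk t) = t.
Proof.
move=> pt; rewrite /walk_to_perm decomp_perm_to_walk // map_rev revK -map_comp.
rewrite map_id_in ?decompK // => p /(allP (decomp_perm_seq pt)).
by case/perm_to_walk_indecP.
Qed.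

Lemma nest_seq_walk_to_perm s : depth_word s -> nest_seq (walk_to_perm s) = rises 0 s.
Proof.
move=> ds; have := decomp_depth_word ds => /allP ds'.
have nest0 : nest_seq [::] = 0 by exact: big_ord0.
rewrite (sumn_dsums (K := perm_seq)) //; first last.
- rewrite all_rev all_map; apply/allP => p /ds' /=.
  by case/walk_to_perm_indecP => /andP[].
- by move=> u v pu _; apply: nest_seq_dsum.
- exact: perm_seq_dsum.
rewrite -[in RHS](decompK s) (sumn_dsums (K := depth_word) (wt := rises 0)) //; first last.
- by apply/allP => p /ds' /andP[].
- exact: rises_dsum.
- exact: depth_word_dsum.
rewrite map_rev sumn_rev -map_comp; congr sumn; apply/eq_in_map => p /ds'.
by case/walk_to_perm_indecP.
Qed.

(** The last drop is that of the last piece, and the reversal puts the image of that piece first. *)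
Lemma head_walk_to_perm s : depth_word s -> s != [::] ->
  head 0 (walk_to_perm s) = last_drop s.
Proof.
move=> ds s0; have := decompK s; have := decomp_depth_word ds; rewrite /walk_to_perm.
case: (lastP (decomp s)) => [|l p]; first by move=> _ s0'; rewrite -s0' in s0.
rewrite all_rcons => /andP[dp _] <-; have [/andP[_ ip] _ hp _ _] := walk_to_perm_indecP dp.
rewrite map_rcons rev_rcons /= head_dsum -1?size_eq0 -?lt0n ?indec_size // hp.
rewrite -cats1 dsums_cat dsums1 last_drop_dsum // -size_eq0 -lt0n indec_size //.
by case/andP: dp.
Qed.

(** * From words to walks and permutations *)

(* Depths [- y] are natural numbers; [d.-1] would be wrong above the x-axis, so
   the lemmas below ask for a walk that stays in the wedge. *)
Fixpoint depths d (p : seq step) : seq nat :=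
  match p with
  | [::] => [::]
  | East :: q => d :: depths d q
  | North :: q => depths d.-1 q
  | South :: q => depths d.+1 q
  end.

Fixpoint end_depth d (p : seq step) : nat :=
  match p with
  | [::] => d
  | East :: q => end_depth d q
  | North :: q => end_depth d.-1 q
  | South :: q => end_depth d.+1 q
  end.

(** The walk starts at [(x, -d)]. Since [d] is a natural number, the upper side of the wedge is
    tested as [0 < d] before each north step. *)
Fixpoint wedge_from x d (p : seq step) : bool :=
  (d <= x) &&
  match p with
  | [::] => true
  | East :: q => wedge_from x.+1 d q
  | North :: q => (0 < d) && wedge_from x d.-1 q
  | South :: q => wedge_from x d.+1 q
  end.

Lemma depths_cat d p q : depths d (p ++ q) = depths d p ++ depths (end_depth d p) q.
Proof. by elim: p d => //= -[] p IHp d /=; rewrite IHp. Qed.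

Lemma end_depth_cat d p q : end_depth d (p ++ q) = end_depth (end_depth d p) q.
Proof. by elim: p d => //= -[] p IHp d /=; rewrite IHp. Qed.

Lemma size_depths d p : size (depths d p) = count_mem East p.
Proof. by elim: p d => //= -[] p IHp d /=; rewrite IHp. Qed.

Lemma wedge_from_cat x d p q : wedge_from x d (p ++ q) =
  wedge_from x d p && wedge_from (x + count_mem East p) (end_depth d p) q.
Proof.
elim: p x d => [|c p IHp] x d /=.
  by rewrite addn0 andbT; case: q => [|c q]; rewrite /= ?andbT ?andbA andbb.
case: c => /=; rewrite IHp ?andbA //.
by rewrite addnA addn1.
Qed.

(** Inside the wedge a north step never starts at depth [0], so the truncated [d.-1] commutes with
    the shift. *)
Lemma wedge_from_shift a x d p : wedge_from x d p ->
  depths (a + d) p = shift a (depths d p) /\ end_depth (a + d) p = a + end_depth d p.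
Proof.
elim: p x d => [|c p IHp] x d //=; case: c => /andP[dx].
- by move=> /IHp[-> ->].
- move=> /andP[d0 /IHp[<- <-]]; have -> // : (a + d).-1 = a + d.-1 by lia.
- by move=> /IHp; rewrite addnS => -[-> ->].
Qed.

Lemma depths_le x d p i : wedge_from x d p -> i < size (depths d p) ->
  nth 0 (depths d p) i <= x + i.
Proof.
elim: p x d i => [|c p IHp] x d i //=; case: c => /andP[dx] /=.
- move=> w; case: i => [|i] /=; first by rewrite addn0.
  by move=> /(IHp _ _ _ w); rewrite addSnnS.
- by move=> /andP[_ w]; apply: IHp.
- exact: IHp.
Qed.

Lemma depth_word_depths p : wedge_from 0 0 p -> depth_word (depths 0 p).
Proof. by move=> w; apply/depth_wordP => i /(depths_le w). Qed.

Section Wedge.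

Local Open Scope ring_scope.

Lemma xend_cat p q : xend (p ++ q) = xend p + xend q.
Proof. by rewrite /xend count_cat PoszD. Qed.

Lemma yend_cat p q : yend (p ++ q) = yend p + yend q.
Proof. by rewrite /yend !count_cat !PoszD; ring. Qed.

Lemma yend_end_depth x d p : wedge_from x d p ->
  yend p = d%:Z - (end_depth d p)%:Z.
Proof.
elim: p x d => [|c p IHp] x d //=; first by rewrite subrr.
rewrite -cat1s yend_cat; case: c => /andP[_].
- by move=> /IHp->; rewrite /yend /=; ring.
- by move=> /andP[d0 /IHp->]; rewrite /yend /= -[in RHS](prednK d0) -addn1 PoszD; ring.
- by move=> /IHp->; rewrite /yend /= -addn1 PoszD; ring.
Qed.

Lemma all_wedge_from (x d : nat) p :
  all (fun k => in_wedge (x%:Z + xend (take k p), - d%:Z + yend (take k p)))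
      (iota 0 (size p).+1) = wedge_from x d p.
Proof.
elim: p x d => [|c p IHp] x d.
  by rewrite /= /in_wedge /xend /yend /=; lia.
rewrite -[size (c :: p)]add1n -addn1 -addnA iotaD all_cat [iota 0 1]/= [all _ [:: 0%N]]/=.
rewrite add0n -[X in iota X _]addn0 iotaDl all_map andbT addn1.
congr (_ && _); first by rewrite /in_wedge /xend /yend /=; lia.
rewrite (eq_all (a2 := fun k => in_wedge (x%:Z + xend [:: c] + xend (take k p),
   - d%:Z + yend [:: c] + yend (take k p)))) => [|k /=]; last first.
  by rewrite -[X in in_wedge X]/(x%:Z + xend ([:: c] ++ take k p),
                                 - d%:Z + yend ([:: c] ++ take k p))
     xend_cat yend_cat !addrA.
case: c.
- have -> : x%:Z + xend [:: East] = x.+1%:Z by rewrite /xend /=; lia.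
  have -> : - d%:Z + yend [:: East] = - d%:Z by rewrite /yend /=; lia.
  exact: IHp.
- have -> : x%:Z + xend [:: North] = x%:Z by rewrite /xend /=; lia.
  (* At depth [0] the north step leaves the wedge at once, and the entry for the empty prefix
     already makes the left side false. *)
  case: d => [|d] /=; first by rewrite /in_wedge /xend /yend take0 /=; lia.
  have -> : - d.+1%:Z + yend [:: North] = - d%:Z by rewrite /yend /=; lia.
  exact: IHp.
- have -> : x%:Z + xend [:: South] = x%:Z by rewrite /xend /=; lia.
  have -> : - d%:Z + yend [:: South] = - d.+1%:Z by rewrite /yend /=; lia.
  exact: IHp.
Qed.

Lemma wedge_pdsawE n p : wedge_pdsaw n p =
  [&& sorted (fun s t => ~~ reversal s t) p, wedge_from 0 0 p,
      end_depth 0 p == n & size (depths 0 p) == n].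
Proof.
rewrite /wedge_pdsaw /partially_directed_saw; congr (_ && _).
rewrite -all_wedge_from (eq_all (a2 := fun k =>
  in_wedge (0%:Z + xend (take k p), - 0%:Z + yend (take k p)))).
  rewrite all_wedge_from size_depths; case w: (wedge_from 0 0 p) => //=.
  rewrite (yend_end_depth w) /xend; case: (count_mem East p =P n) => [->|];
    last by rewrite !andbF.
  rewrite !andbT; lia.
by move=> k; rewrite oppr0 !add0r.
Qed.

Lemma east_belowP x d c p : wedge_from x d p ->
  all (leq c) (depths d p) <->
  (forall u v, p = u ++ East :: v -> - d%:Z + yend u <= - c%:Z).
Proof.
elim: p x d => [|e p IHp] x d /=; first by split=> // _ [].
case: e => /andP[_ w] /=.
- have IH := IHp _ _ w; split=> [/andP[cd /IH ball] [|e u] v [] // | ball].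
  + by move=> _; rewrite /yend /=; lia.
  + by move=> <- /ball; rewrite -cat1s yend_cat /yend /=; lia.
  apply/andP; split; first by have := ball [::] p erefl; rewrite /yend /=; lia.
  apply/IH => u v ep; have := ball (East :: u) v; rewrite ep => /(_ erefl).
  by rewrite -cat1s yend_cat /yend /=; lia.
- move: w => /andP[d0 w]; have IH := IHp _ _ w; split=> [/IH ball [|e u] v [] // | ball].
    by move=> <- /ball; rewrite -cat1s yend_cat /yend /=; lia.
  apply/IH => u v ep; have := ball (North :: u) v; rewrite ep => /(_ erefl).
  by rewrite -cat1s yend_cat /yend /=; lia.
- have IH := IHp _ _ w; split=> [/IH ball [|e u] v [] // | ball].
    by move=> <- /ball; rewrite -cat1s yend_cat /yend /=; lia.
  apply/IH => u v ep; have := ball (South :: u) v; rewrite ep => /(_ erefl).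
  by rewrite -cat1s yend_cat /yend /=; lia.
Qed.

End Wedge.

(** * Rebuilding a walk from its depth word *)

Definition vertical d h := nseq (h - d) South ++ nseq (d - h) North.

(** [e] is the final depth. Truncation leaves at most one block of each [vertical] nonempty, so no
    reversal occurs. *)
Fixpoint word d (s : seq nat) e : seq step :=
  if s is h :: s' then vertical d h ++ East :: word h s' e else vertical d e.

Lemma depths_south d k p : depths d (nseq k South ++ p) = depths (d + k) p.
Proof. by elim: k d => [|k IHk] d /=; rewrite ?addn0 // IHk addSnnS. Qed.

Lemma depths_north d k p : depths d (nseq k North ++ p) = depths (d - k) p.
Proof. by elim: k d => [|k IHk] d /=; rewrite ?subn0 // IHk -subn1 -subnDA add1n. Qed.

Lemma end_depth_south d k p : end_depth d (nseq k South ++ p) = end_depth (d + k) p.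
Proof. by elim: k d => [|k IHk] d /=; rewrite ?addn0 // IHk addSnnS. Qed.

Lemma end_depth_north d k p : end_depth d (nseq k North ++ p) = end_depth (d - k) p.
Proof. by elim: k d => [|k IHk] d /=; rewrite ?subn0 // IHk -subn1 -subnDA add1n. Qed.

Lemma wedge_south x d k p : d + k <= x ->
  wedge_from x d (nseq k South ++ p) = wedge_from x (d + k) p.
Proof.
elim: k d => [|k IHk] d dk /=; first by rewrite addn0.
by rewrite IHk addSnnS ?dk // (leq_trans _ dk) // leq_addr.
Qed.

Lemma wedge_north x d k p : d <= x -> k <= d ->
  wedge_from x d (nseq k North ++ p) = wedge_from x (d - k) p.
Proof.
elim: k d => [|k IHk] d dx kd /=; first by rewrite subn0.
rewrite dx (leq_ltn_trans _ kd) //= IHk; [|lia|lia].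
by congr wedge_from; lia.
Qed.

Lemma add_sub_vertical d h : d + (h - d) - (d - h) = h.
Proof. lia. Qed.

Lemma depths_vertical d h p : depths d (vertical d h ++ p) = depths h p.
Proof. by rewrite /vertical -catA depths_south depths_north add_sub_vertical. Qed.

Lemma end_depth_vertical d h p : end_depth d (vertical d h ++ p) = end_depth h p.
Proof. by rewrite /vertical -catA end_depth_south end_depth_north add_sub_vertical. Qed.

Lemma wedge_vertical x d h p : d <= x -> h <= x ->
  wedge_from x d (vertical d h ++ p) = wedge_from x h p.
Proof.
move=> dx hx; rewrite /vertical -catA wedge_south; last lia.
by rewrite wedge_north ?add_sub_vertical; lia.
Qed.

Lemma depths_word d s e : depths d (word d s e) = s.
Proof.
elim: s d => [|h s IHs] d /=; last by rewrite depths_vertical /= IHs.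
by rewrite -[vertical d e]cats0 depths_vertical.
Qed.

Lemma end_depth_word d s e : end_depth d (word d s e) = e.
Proof.
elim: s d => [|h s IHs] d /=; last by rewrite end_depth_vertical /= IHs.
by rewrite -[vertical d e]cats0 end_depth_vertical.
Qed.

Lemma wedge_from_word x d s e : d <= x -> e <= x + size s ->
  (forall i, i < size s -> nth 0 s i <= x + i) -> wedge_from x d (word d s e).
Proof.
elim: s x d => [|h s IHs] x d dx /= ex sx.
  by rewrite addn0 in ex; rewrite -[vertical d e]cats0 wedge_vertical //= andbT.
have hx : h <= x by have := sx 0 isT; rewrite addn0.
rewrite wedge_vertical //= hx IHs //; [exact: leqW | by rewrite addSnnS |].
by move=> i si; rewrite addSnnS; apply: (sx i.+1).
Qed.

Local Notation no_reversal := (fun s t => ~~ reversal s t).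

Lemma path_nseq (k : nat) (c : step) :
  path no_reversal East (nseq k c).
Proof.
by case: k => //= k; case: c; elim: k.
Qed.

Lemma path_East c u w : path no_reversal c (u ++ East :: w) =
  path no_reversal c u && path no_reversal East w.
Proof. by rewrite cat_path /= /reversal /= !andbF. Qed.

Lemma sorted_word d s e : sorted no_reversal (word d s e).
Proof.
have vert a b : path no_reversal East (vertical a b).
  rewrite /vertical; case: (leqP a b) => [ab|/ltnW ab].
    by rewrite (eqP ab) cats0 path_nseq.
  by rewrite (eqP ab) path_nseq.
(* An east step imagined in front is compatible with every first step, which gives an induction
   through [path_East]. *)
have: path no_reversal East (word d s e); last by case: word => //= c p /andP[].
elim: s d => [|h s IHs] d //=.
by rewrite path_East vert IHs.
Qed.


Lemma word_south d s e : d < head e s -> word d s e = South :: word d.+1 s e.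
Proof.
have v h : d < h -> vertical d h = South :: vertical d.+1 h.
  move=> dh; rewrite /vertical -(subnSK dh) /=; congr (_ :: (_ ++ nseq _ _)); lia.
by case: s => [|h s] /= dh; rewrite v.
Qed.

Lemma word_north d s e : head e s < d -> word d s e = North :: word d.-1 s e.
Proof.
have v h : h < d -> vertical d h = North :: vertical d.-1 h.
  move=> hd; rewrite /vertical; case: d hd => // d hd /=.
  have -> : h - d.+1 = 0 by lia.
  have -> : h - d = 0 by lia.
  by rewrite subSn.
by case: s => [|h s] /= dh; rewrite v.
Qed.

(** After a south step no north step can come before the next east step, so the next depth, or the
    final one if no east step follows, is at least [d]. *)
Lemma depths_after_south x d p : wedge_from x d p -> path no_reversal South p ->
  d <= head (end_depth d p) (depths d p).
Proof.
elim: p x d => [|c p IHp] x d //=; case: c => //= /andP[_ w] pth.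
by rewrite ltnW // (IHp _ _ w).
Qed.

Lemma depths_after_north x d p : wedge_from x d p -> path no_reversal North p ->
  head (end_depth d p) (depths d p) <= d.
Proof.
elim: p x d => [|c p IHp] x d //=; case: c => //= /and3P[_ d0 w] pth.
by rewrite (leq_trans (IHp _ _ w pth)) // leq_pred.
Qed.

(** Without reversals each vertical run is monotone, hence determined by the depths at its two
    ends. *)
Lemma wordK x d p : wedge_from x d p -> sorted no_reversal p ->
  word d (depths d p) (end_depth d p) = p.
Proof.
elim: p x d => [|c p IHp] x d /=; first by rewrite /vertical subnn.
have sort_p (e : step) : path no_reversal e p -> sorted no_reversal p.
  by case: p {IHp} => //= e' p /andP[].
case: c => /andP[_ w] pth; have srt := sort_p _ pth.
- by rewrite /= /vertical subnn /= (IHp _ _ w).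
- case/andP: w => d0 w; rewrite word_north ?(IHp _ _ w) //.
  by have := depths_after_north w pth; lia.
- rewrite word_south ?(IHp _ _ w) //.
  exact: depths_after_south w pth.
Qed.

Lemma wedge_pdsaw_word s : depth_word s -> wedge_pdsaw (size s) (word 0 s (size s)).
Proof.
move=> /depth_wordP ds; rewrite wedge_pdsawE sorted_word depths_word end_depth_word.
rewrite !eqxx andbT.
by rewrite wedge_from_word.
Qed.

Lemma count_north_vertical d h : count_mem North (vertical d h) = d - h.
Proof. by rewrite count_cat !count_nseq /= mul0n mul1n. Qed.

Lemma north_steps_word d s e :
  north_steps (word d s e) = rises d s + (last d s - e).
Proof.
rewrite /north_steps; elim: s d => [|h s IHs] d /=.
  by rewrite count_north_vertical.
by rewrite count_cat count_north_vertical /= add0n IHs addnA.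
Qed.

Lemma last_descent_cat u k : last_descent (u ++ East :: nseq k South) = k.
Proof.
rewrite /last_descent rev_cat rev_cons -cats1 -catA.
rewrite rev_nseq.
have East_notin : East \notin nseq k South by rewrite mem_nseq andbF.
rewrite index_cat (negPf East_notin) /= addn0 take_size_cat //.
by rewrite count_nseq /= mul1n.
Qed.

Lemma last_descent_word s e : s != [::] -> last 0 s <= e ->
  last_descent (word 0 s e) = e - last 0 s.
Proof.
move=> s0 le; have word_last d : exists u,
    word d s e = u ++ East :: vertical (last 0 s) e.
  elim: s s0 d {le} => //= h [|k s] IHs _ d; first by exists (vertical d h).
  have [u /= ->] := IHs isT h; exists (vertical d h ++ East :: u).
  by rewrite -catA.
have [u ->] := word_last 0.
by rewrite /vertical (eqP le) cats0 last_descent_cat.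
Qed.

(** * Statistics of a walk read off its depth word *)

Section Pdsaw.

Variable n : nat.
Implicit Type P : pdsaw n.

Lemma pdsaw_spec P : [/\ sorted no_reversal P, wedge_from 0 0 P,
  end_depth 0 P = n & size (depths 0 P) = n].
Proof. by have := stepsP P; rewrite wedge_pdsawE => /and4P[? ? /eqP ? /eqP ?]. Qed.

Lemma pdsaw_depth_word P : depth_word (depths 0 P).
Proof. by have [_ w _ _] := pdsaw_spec P; apply: depth_word_depths. Qed.

Lemma pdsawK P : word 0 (depths 0 P) n = P.
Proof. by have [srt w ed _] := pdsaw_spec P; rewrite -[X in word _ _ X]ed (wordK w). Qed.

Lemma north_steps_pdsaw P : north_steps P = rises 0 (depths 0 P).
Proof.
have [_ _ _ sz] := pdsaw_spec P; rewrite -[in LHS]pdsawK north_steps_word.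
(* The last run goes from depth at most [n.-1] to depth [n], so it has no north step. *)
have := depth_word_last (pdsaw_depth_word P); rewrite sz => le_n.
by apply/eqP; rewrite -[X in _ == X]addn0 eqn_add2l subn_eq0 (leq_trans le_n) // leq_pred.
Qed.

Lemma last_descent_pdsaw P : 0 < n -> last_descent P = (last_drop (depths 0 P)).+1.
Proof.
move=> n0; have [_ _ _ sz] := pdsaw_spec P; rewrite -[in LHS]pdsawK.
have := depth_word_last (pdsaw_depth_word P); rewrite sz => le_n.
rewrite last_descent_word; first by rewrite /last_drop sz; lia.
  by rewrite -size_eq0 sz -lt0n.
by rewrite (leq_trans le_n) // leq_pred.
Qed.

End Pdsaw.

(** * Prime factors of walks are the indecomposable pieces of depth words *)

Lemma depths_split c d p : c < size (depths d p) ->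
  exists u v, p = u ++ East :: v /\ size (depths d u) = c.
Proof.
elim: p c d => [|e p IHp] c d //=; case: e => /=; first case: c => [_|c].
- by exists [::], p.
- by rewrite ltnS => /IHp[u [v [-> <-]]]; exists (East :: u), v.
- by move=> /IHp[u [v [-> <-]]]; exists (North :: u), v.
- by move=> /IHp[u [v [-> <-]]]; exists (South :: u), v.
Qed.

Section WalkFactor.

Variables (n m : nat) (P : pdsaw n) (Q : pdsaw m) (a : nat).
Hypothesis PQ : walk_factor P a (a + m) Q.

Lemma walk_factor_depths :
  exists s t, [/\ steps P = s ++ steps Q ++ t, end_depth 0 s = a, size (depths 0 s) = a,
    all (leq a) (depths a (steps Q ++ t)) & all (leq (a + m)) (depths (a + m) t)].
Proof.
have [_ [s [t [eP es esq bs bsq]]]] := PQ; exists s, t.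
have [_ + _ _] := pdsaw_spec P; rewrite eP wedge_from_cat => /andP[ws].
have [_ wQ eQ sQ] := pdsaw_spec Q.
have [xs ys] : xend s = a%:Z%R /\ yend s = (- a%:Z)%R
  by split; [apply: (congr1 fst es) | apply: (congr1 snd es)].
have ds : end_depth 0 s = a by have := yend_end_depth ws; rewrite ys; lia.
have zs : size (depths 0 s) = a by rewrite size_depths; move: xs => -[].
have [dQ eaQ] := wedge_from_shift a wQ; rewrite addn0 eQ in dQ eaQ.
rewrite add0n -(size_depths 0) zs ds => wqt; split=> //.
  by apply/(east_belowP _ wqt) => u v e; have := bs _ _ e; rewrite yend_cat ys.
move: wqt; rewrite wedge_from_cat -(size_depths a) dQ size_shift sQ eaQ => /andP[_ wt].
apply/(east_belowP _ wt) => u v e; have := bsq _ _ e.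
have ysq : yend (s ++ steps Q) = (- (a + m)%:Z)%R by apply: (congr1 snd esq).
by rewrite yend_cat ysq.
Qed.

Lemma walk_factor_drop :
  drop a (depths 0 P) = shift a (depths 0 Q) ++ drop (a + m) (depths 0 P).
Proof.
have [s [t [-> ds zs _ _]]] := walk_factor_depths.
have [_ wQ eQ sQ] := pdsaw_spec Q.
have [dQ eaQ] := wedge_from_shift a wQ; rewrite addn0 eQ in dQ eaQ.
have sz : size (depths 0 s ++ shift a (depths 0 Q)) = a + m.
  by rewrite size_cat zs size_shift sQ.
rewrite !depths_cat ds dQ eaQ drop_size_cat //; congr (_ ++ _).
by rewrite catA drop_size_cat.
Qed.

(** A proper cut of the depth word yields a shorter factor with the same start, so a prime factor
    has an indecomposable word. *)
Lemma walk_factor_cut c : 0 < c < m -> cut c (depths 0 Q) ->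
  exists q, walk_factor P a (a + c) q.
Proof.
move=> /andP[c0 cm] cutQ; have [s [t [eP ds zs ba bt]]] := walk_factor_depths.
have [_ wP _ _] := pdsaw_spec P; have [_ wQ eQ sQ] := pdsaw_spec Q.
have cQ : c < size (depths 0 Q) by rewrite sQ.
(* [u] includes the vertical run before its next east step. That east step has depth at most [c] by
   the wedge and at least [c] by the cut, so [u] ends on the line [y = -x]. *)
have [u [v [eu zu]]] := depths_split cQ.
have dQ : depths 0 Q = depths 0 u ++ depths (end_depth 0 u) (East :: v).
  by rewrite eu depths_cat.
have du : end_depth 0 u = c.
  apply/eqP; rewrite eqn_leq; apply/andP; split.
    by have := depths_le wQ cQ; rewrite dQ nth_cat zu ltnn subnn.
  by move: cutQ; rewrite /cut dQ -zu drop_size_cat // zu => /andP[].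
have wu : wedge_from 0 0 u by move: wQ; rewrite eu wedge_from_cat => /andP[].
have wv : wedge_from c c (East :: v).
  by move: wQ; rewrite eu wedge_from_cat du -(size_depths 0) zu => /andP[].
have ws : wedge_from 0 0 s by move: wP; rewrite eP wedge_from_cat => /andP[].
have wuv : wedge_from a a (u ++ East :: v ++ t).
  move: wP; rewrite eP wedge_from_cat ds -(size_depths 0) zs => /andP[_].
  by rewrite eu -catA.
have [_ dau] := wedge_from_shift a wu; rewrite addn0 du in dau.
have xs : xend s = a%:Z%R by rewrite /xend -(size_depths 0) zs.
have ys : yend s = (- a%:Z)%R by rewrite (yend_end_depth ws) ds; lia.
have xsu : xend (s ++ u) = (a + c)%:Z%R.
  by rewrite xend_cat xs [xend u]/xend -(size_depths 0) zu.
have ysu : yend (s ++ u) = (- (a + c)%:Z)%R.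
  by rewrite yend_cat ys (yend_end_depth wu) du; lia.
exists u; split; first by rewrite -[X in X < _]addn0 ltn_add2l.
exists s, (East :: v ++ t); split.
- by rewrite eP eu -catA.
- by rewrite /endpoint xs ys.
- by rewrite /endpoint xsu ysu.
- move=> u' v' e; rewrite yend_cat ys; apply: (east_belowP a wuv).1 e.
  by move: ba; rewrite eu -catA.
- have wvt : wedge_from (a + c) (a + c) (East :: v ++ t).
    by move: wuv; rewrite wedge_from_cat dau -(size_depths 0) zu => /andP[].
  move=> u' v' e; rewrite yend_cat ysu; apply: (east_belowP (a + c) wvt).1 e.
  have [dav eav] := wedge_from_shift a wv.
  rewrite -cat_cons depths_cat all_cat dav eav; apply/andP; split.
    have cv : all (leq c) (depths c (East :: v)).
      by move: cutQ; rewrite /cut dQ du drop_size_cat.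
    by rewrite all_map; apply: sub_all cv => x /=; rewrite leq_add2l.
  have -> : end_depth c (East :: v) = m by rewrite -eQ eu end_depth_cat du.
  by apply: sub_all bt => x /=; apply: leq_trans; rewrite leq_add2l ltnW.
Qed.

End WalkFactor.

Lemma prime_walk_factor_indec n m (P : pdsaw n) (Q : pdsaw m) a :
  prime_factor (walk_factor P) a (a + m) (steps Q) -> indec (depths 0 Q).
Proof.
move=> [PQ prime_Q]; have [_ _ _ sQ] := pdsaw_spec Q.
have m0 : 0 < m by have [+ _] := PQ; rewrite -[X in X < _]addn0 ltn_add2l.
apply/andP; split; first by rewrite -size_eq0 sQ -lt0n.
apply/allP => /= c; rewrite mem_iota sQ => cm; apply/negP => cutQ.
have c_lt : 0 < c < m by lia.
have [q PQ'] := walk_factor_cut PQ c_lt cutQ.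
have [||_] := prime_Q _ _ _ PQ'; [by [] | by rewrite leq_add2l; lia | lia].
Qed.

Lemma walk_prime_factors_drop n (P : pdsaw n) a l :
    consecutive
      (fun a b Q => prime_factor (walk_factor P) a b (steps (tagged Q))) a n l ->
  let ds := [seq depths 0 (steps (tagged Q)) | Q : {m : nat & pdsaw m} <- l] in
  all indec ds /\ drop a (depths 0 P) = shift a (dsums ds).
Proof.
have [_ _ _ sP] := pdsaw_spec P; elim: l a => [|[m Q] l IHl] a /=.
  by move=> ->; rewrite drop_oversize ?sP.
move=> [PQ /IHl[il eP]]; rewrite (prime_walk_factor_indec PQ) il; split=> //.
rewrite (walk_factor_drop PQ.1) eP shift_cat shift_shift.
by have [_ _ _ ->] := pdsaw_spec Q.
Qed.

Lemma walk_prime_factors_decomp n (P : pdsaw n) l : walk_prime_factors P l ->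
  decomp (depths 0 P) = [seq depths 0 (steps (tagged Q)) | Q : {m : nat & pdsaw m} <- l].
Proof.
by move=> /walk_prime_factors_drop[il]; rewrite drop0 shift0 => ->; rewrite dsumsK.
Qed.

(** * Indecomposable pieces of permutation words are prime factors *)

Lemma perm_stable_geq n (s : 'S_n) a : (forall i : 'I_n, i < a -> s i < a) ->
  forall i : 'I_n, a <= i -> a <= s i.
Proof.
move=> sa i ai; rewrite leqNgt; apply/negP => si.
(* [s] maps the finite set [A] injectively into itself, hence onto it, so no position outside [A]
   takes a value below [a]. *)
pose A := [set j : 'I_n | j < a].
have sAA : s @: A = A.
  apply/eqP; rewrite eqEcard card_imset ?leqnn ?andbT; last exact: perm_inj.
  by apply/subsetP => _ /imsetP[j + ->]; rewrite !inE; apply: sa.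
have : s i \in s @: A by rewrite sAA inE.
by rewrite mem_imset ?inE ?ltnNge ?ai //; apply: perm_inj.
Qed.

Section PermFactor.

Variables (n : nat) (s : 'S_n) (u v : seq nat) (Q : {m : nat & 'S_m}).
Hypothesis sE : perm_word s = dsum u (dsum (perm_word (tagged Q)) v).
Hypothesis pu : perm_seq u.
Notation a := (size u).
Notation m := (tag Q).

Let nth_s (i : 'I_n) : s i = nth 0 (dsum u (dsum (perm_word (tagged Q)) v)) i :> nat.
Proof. by rewrite -sE nth_perm_word. Qed.

Let an : a + m <= n.
Proof. by rewrite -(size_perm_word s) sE !size_dsum size_perm_word; lia. Qed.

Lemma perm_factor_dsum : 0 < m -> perm_factor s a (a + m) Q.
Proof.
move=> m0; split; first by rewrite an andbT -[X in X < _]addn0 ltn_add2l.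
- by move=> i iu; rewrite nth_s nth_cat iu perm_seq_lt.
- move=> i ai; rewrite nth_s.
  have cuts : cut (a + m) (dsum u (dsum (perm_word (tagged Q)) v)).
    by rewrite cut_dsum_shift -[X in cut X _](size_perm_word (tagged Q)) cut_dsum_l.
  rewrite -(subnKC ai) -nth_drop; apply: (allP cuts); apply: mem_nth.
  by rewrite size_drop -sE size_perm_word ltn_sub2r // (leq_ltn_trans ai).
- move=> i j ij; rewrite nth_s ij nth_cat ltnNge leq_addr /= addKn.
  have jm : j < size (perm_word (tagged Q)) by rewrite size_perm_word.
  rewrite (nth_map 0) ?size_dsum ?ltn_addr //.
  by rewrite nth_cat jm nth_perm_word.
Qed.

Lemma prime_perm_factor_dsum : indec (perm_word (tagged Q)) ->
  prime_factor (perm_factor s) a (a + m) Q.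
Proof.
move=> iQ; have m0 : 0 < m by rewrite -(size_perm_word (tagged Q)) indec_size.
split; first exact: perm_factor_dsum.
move=> a' b' x' [[/andP[ab bn] _] lt_a ge_b _] aa' b'b.
(* A strictly smaller factor would start or end strictly inside the piece, and either end is a cut
   of the whole word, hence of this indecomposable piece. *)
have no_cut c : a < c < a + m -> ~ (forall i : 'I_n, c <= i -> c <= s i).
  move=> /andP[ac cm] cs.
  have /negP[] : ~~ cut (c - a) (perm_word (tagged Q)).
    by apply: indecP => //; rewrite size_perm_word; lia.
  have : cut c (perm_word s).
    apply/(all_nthP 0) => i; rewrite size_drop size_perm_word => ic.
    have cin : c + i < n by lia.
    by rewrite nth_drop (nth_perm_word s (Ordinal cin)) cs //= leq_addr.
  rewrite sE -[X in cut X _](subnKC (ltnW ac)) cut_dsum_shift.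
  by apply: cut_prefix; rewrite size_perm_word; lia.
split; apply/eqP; rewrite eqn_leq.
  rewrite aa' andbT leqNgt; apply/negP => lt_aa'.
  by apply: (no_cut a'); [lia | apply: perm_stable_geq].
rewrite b'b leqNgt; apply/negP => lt_b.
by apply: (no_cut b'); [lia | apply: ge_b].
Qed.

End PermFactor.

Lemma perm_prime_factors_dsums n (s : 'S_n) (l : seq {m : nat & 'S_m}) :
    perm_word s = dsums [seq perm_word (tagged Q) | Q : {m : nat & 'S_m} <- l] ->
    all indec [seq perm_word (tagged Q) | Q : {m : nat & 'S_m} <- l] ->
  perm_prime_factors s l.
Proof.
rewrite -[dsums _]dsum0s; have : perm_seq [::] by [].
rewrite /perm_prime_factors -[X in consecutive _ X]/(size (Nil nat)).
(* The induction carries the direct sum [u] of the factors already passed; its size is the point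
   where the next factor starts. *)
elim: l [::] => [|Q l IHl] u pu /= sE.
  by move=> _; rewrite -(size_perm_word s) sE dsums0.
move=> /andP[iQ il]; split; first exact: prime_perm_factor_dsum sE pu iQ.
rewrite -[X in size u + X](size_perm_word (tagged Q)) -size_dsum; apply: IHl => //.
  by rewrite perm_seq_dsum pu perm_seq_word.
by rewrite -dsumA.
Qed.

(** * The bijection from walks to permutations *)

Definition walk_perm n (P : pdsaw n) : 'S_n :=
  odflt 1%g [pick s : 'S_n | perm_word s == walk_to_perm (depths 0 P)].

Lemma perm_word_walk_perm n (P : pdsaw n) :
  perm_word (walk_perm P) = walk_to_perm (depths 0 P).
Proof.
(* The default permutation is excluded: the word is a permutation word of size [n], so [pick]
   succeeds. *)
rewrite /walk_perm; case: pickP => [s /eqP //|no_s].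
have dP := pdsaw_depth_word P; have [_ _ _ sP] := pdsaw_spec P.
have [|s /eqP] := perm_word_surj (n := n) _ (perm_seq_walk_to_perm dP).
  by rewrite size_walk_to_perm.
by rewrite no_s.
Qed.

Lemma perm_pdsaw_proof n (s : 'S_n) :
  wedge_pdsaw n (word 0 (perm_to_walk (perm_word s)) n).
Proof.
have ps := perm_seq_word s.
rewrite -[X in wedge_pdsaw X](size_perm_word s) -(size_perm_to_walk ps).
by rewrite -[X in word _ _ X](size_perm_word s) -(size_perm_to_walk ps);
  apply/wedge_pdsaw_word/depth_word_perm_to_walk.
Qed.

Lemma walk_perm_bij n : bijective (@walk_perm n).
Proof.
exists (fun s => Pdsaw (perm_pdsaw_proof s)) => [P|s].
  apply: val_inj => /=; rewrite perm_word_walk_perm walk_to_permK ?pdsawK //.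
  exact: pdsaw_depth_word.
apply: perm_word_inj; rewrite perm_word_walk_perm /= depths_word.
exact/perm_to_walkK/perm_seq_word.
Qed.

Lemma nestings_walk_perm n (P : pdsaw n) : nestings (walk_perm P) = north_steps P.
Proof.
rewrite nestings_word perm_word_walk_perm north_steps_pdsaw.
exact/nest_seq_walk_to_perm/pdsaw_depth_word.
Qed.

Lemma walk_perm_first n (n_gt0 : 0 < n) (P : pdsaw n) :
  (walk_perm P (Ordinal n_gt0)).+1 = last_descent P.
Proof.
rewrite last_descent_pdsaw // -nth_perm_word /= nth0 perm_word_walk_perm.
rewrite head_walk_to_perm ?pdsaw_depth_word //.
by have [_ _ _ sP] := pdsaw_spec P; rewrite -size_eq0 sP -lt0n.
Qed.

Local Open Scope ring_scope.

Theorem theorem1p5 :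
  exists Psi : forall n : nat, pdsaw n -> 'S_n,
    (forall (n : nat) (n_gt0 : (0 < n)%N),
       bijective (Psi n) /\
       forall (P : pdsaw n) (N M : int),
         ((north_steps P)%:Z = N /\ (last_descent P)%:Z = M) <->
         ((nestings (Psi n P))%:Z = N /\
          (Psi n P (Ordinal n_gt0)).+1%:Z = M)) /\
    (forall (n : nat), (0 < n)%N ->
       forall (P : pdsaw n) (l : seq {m : nat & pdsaw m}),
         walk_prime_factors P l ->
         perm_prime_factors (Psi n P)
           (rev [seq existT (fun m : nat => 'S_m) (tag Q) (Psi (tag Q) (tagged Q))
                | Q <- l])).
Proof.
exists walk_perm; split=> [n n_gt0|n _ P l fP].
  split; first exact: walk_perm_bij.
  by move=> P N M; rewrite nestings_walk_perm walk_perm_first.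
have eP := walk_prime_factors_decomp fP.
have dP := decomp_walk_to_perm (pdsaw_depth_word P).
pose f (Q : {m : nat & pdsaw m}) : {m : nat & 'S_m} :=
  existT (fun m : nat => 'S_m) (tag Q) (walk_perm (tagged Q)).
have wordE :
    [seq perm_word (tagged Q) | Q : {m : nat & 'S_m} <- rev [seq f Q | Q <- l]] =
    decomp (walk_to_perm (depths 0 P)).
  rewrite dP eP map_rev -!map_comp; congr rev.
  have : all indec [seq depths 0 (steps (tagged Q)) | Q : {m : nat & pdsaw m} <- l].
    by rewrite -eP decomp_indec.
  (* A prime factor has a one-piece decomposition, so on it [walk_to_perm] is [walk_to_perm_indec],
     the map applied to that piece inside [P]. *)
  elim: l {eP fP} => //= Q l IHl /andP[iQ /IHl->]; congr (_ :: _).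
  rewrite perm_word_walk_perm /walk_to_perm.
  have -> : decomp (depths 0 (tagged Q)) = [:: depths 0 (tagged Q)].
    by rewrite -[in LHS](dsums1 (depths _ _)) dsumsK //= iQ.
  by rewrite /= dsums0.
apply: perm_prime_factors_dsums; rewrite wordE ?decompK ?decomp_indec //.
exact: perm_word_walk_perm.
Qed.
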